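(* Let $\Gamma$ be a group containing a non-abelian free subgroup. Then $\Gamma$ is not strongly Ulam stable; in fact $F_\Gamma(\delta) \ge \frac{\sqrt{3}}{16}$ for every $\delta > 0$.
   Context: For a Hilbert space $\mathcal H$, $U(\mathcal H)$ is its unitary group and $\|\cdot\|$ the operator norm. For maps $\mu,\nu:\Gamma\to U(\mathcal H)$ put $\|\mu-\nu\|=\sup_{\gamma\in\Gamma}\|\mu(\gamma)-\nu(\gamma)\|$. Define $D(\mu)=\inf\{\|\mu-\nu\| : \nu\in \mathrm{Hom}(\Gamma,U(\mathcal H))\}$ and the defect $\mathrm{def}(\mu)=\sup_{x,y\in\Gamma}\|\mu(xy)-\mu(x)\mu(y)\|$. For $\delta\ge 0$, $F_\Gamma(\delta)=\sup\{D(\mu): \mathrm{def}(\mu)\le\delta,\ \mu(e)=\mathrm{Id}\}$, the supremum over all Hilbert spaces $\mathcal H$ and all maps $\mu:\Gamma\to U(\mathcal H)$ with $\mu(e)=\mathrm{Id}$. Put $\mathrm{def}(\Gamma)=\lim_{\delta\to0^+}F_\Gamma(\delta)$. $\Gamma$ is strongly Ulam stable if $\mathrm{def}(\Gamma)=0$. *)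

(* Defs.v *)
From Stdlib Require Import Reals List.
Open Scope R_scope.

Record Cx := mkC { Cre : R ; Cim : R }.
Definition C0 : Cx := mkC 0 0.
Definition C1 : Cx := mkC 1 0.
Definition Cadd (a b : Cx) : Cx := mkC (Cre a + Cre b) (Cim a + Cim b).
Definition Cmul (a b : Cx) : Cx :=
  mkC (Cre a * Cre b - Cim a * Cim b) (Cre a * Cim b + Cim a * Cre b).
Definition Cconj (a : Cx) : Cx := mkC (Cre a) (- Cim a).

Record HilbertSpace := {
  hcar :> Type;
  hzero : hcar;
  hadd : hcar -> hcar -> hcar;
  hopp : hcar -> hcar;
  hscal : Cx -> hcar -> hcar;
  inner : hcar -> hcar -> Cx;
  hadd_assoc : forall u v w, hadd u (hadd v w) = hadd (hadd u v) w;
  hadd_comm : forall u v, hadd u v = hadd v u;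
  hadd_zero : forall u, hadd u hzero = u;
  hadd_opp : forall u, hadd u (hopp u) = hzero;
  hscal_one : forall u, hscal C1 u = u;
  hscal_assoc : forall a b u, hscal a (hscal b u) = hscal (Cmul a b) u;
  hscal_distr_vec : forall a u v, hscal a (hadd u v) = hadd (hscal a u) (hscal a v);
  hscal_distr_scal : forall a b u, hscal (Cadd a b) u = hadd (hscal a u) (hscal b u);
  inner_add_l : forall u v w, inner (hadd u v) w = Cadd (inner u w) (inner v w);
  inner_scal_l : forall a u w, inner (hscal a u) w = Cmul a (inner u w);
  inner_conj_sym : forall u v, inner v u = Cconj (inner u v);
  inner_pos : forall u, 0 <= Cre (inner u u);
  inner_definite : forall u, Cre (inner u u) = 0 -> u = hzero;
  hcomplete : forall s : nat -> hcar,
    (forall eps, 0 < eps -> exists N, forall m n, (N <= m)%nat -> (N <= n)%nat ->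
        sqrt (Cre (inner (hadd (s m) (hopp (s n))) (hadd (s m) (hopp (s n))))) < eps) ->
    exists l, forall eps, 0 < eps -> exists N, forall n, (N <= n)%nat ->
        sqrt (Cre (inner (hadd (s n) (hopp l)) (hadd (s n) (hopp l)))) < eps
}.

Arguments hzero {_}. Arguments hadd {_}. Arguments hopp {_}.
Arguments hscal {_}. Arguments inner {_}.

Definition hnorm {H : HilbertSpace} (u : H) : R := sqrt (Cre (inner u u)).
Definition hsub {H : HilbertSpace} (u v : H) : H := hadd u (hopp v).

Definition is_unitary {H : HilbertSpace} (U : H -> H) : Prop :=
  (forall u v, U (hadd u v) = hadd (U u) (U v)) /\
  (forall a u, U (hscal a u) = hscal a (U u)) /\
  (forall u v, inner (U u) (U v) = inner u v) /\
  (forall v, exists u, U u = v).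

Definition opdist_le {H : HilbertSpace} (A B : H -> H) (r : R) : Prop :=
  0 <= r /\ forall v, hnorm (hsub (A v) (B v)) <= r * hnorm v.

Record Group := {
  gcar :> Type;
  gmul : gcar -> gcar -> gcar;
  gone : gcar;
  ginv : gcar -> gcar;
  gmul_assoc : forall x y z, gmul x (gmul y z) = gmul (gmul x y) z;
  gmul_one_l : forall x, gmul gone x = x;
  gmul_one_r : forall x, gmul x gone = x;
  gmul_inv_l : forall x, gmul (ginv x) x = gone;
  gmul_inv_r : forall x, gmul x (ginv x) = gone
}.
Arguments gmul {_}. Arguments gone {_}. Arguments ginv {_}.

Fixpoint eval_word {G : Group} {I : Type} (f : I -> G) (w : list (I * bool)) : G :=
  match w with
  | nil => gone
  | (i, s) :: w' => gmul (if s then f i else ginv (f i)) (eval_word f w')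
  end.

Fixpoint reduced_word {I : Type} (w : list (I * bool)) : Prop :=
  match w with
  | (i, s) :: (((j, t) :: _) as w') => ~ (i = j /\ s <> t) /\ reduced_word w'
  | _ => True
  end.

(* f : I -> G freely generates the subgroup it generates (a free subgroup with
   basis f) iff no nonempty reduced word evaluates to the identity. *)
Definition free_family {G : Group} {I : Type} (f : I -> G) : Prop :=
  forall w, w <> nil -> reduced_word w -> eval_word f w <> gone.

Definition has_nonabelian_free_subgroup (G : Group) : Prop :=
  exists (I : Type) (f : I -> G), free_family f /\ exists i j : I, i <> j.

Section Ulam.
Context {G : Group} {H : HilbertSpace}.

Definition is_unitary_map (mu : G -> H -> H) : Prop := forall g, is_unitary (mu g).

Definition is_hom (nu : G -> H -> H) : Prop :=
  is_unitary_map nu /\ forall x y v, nu (gmul x y) v = nu x (nu y v).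

Definition mapdist_le (mu nu : G -> H -> H) (r : R) : Prop :=
  forall g, opdist_le (mu g) (nu g) r.

Definition defect_le (mu : G -> H -> H) (delta : R) : Prop :=
  forall x y, opdist_le (mu (gmul x y)) (fun v => mu x (mu y v)) delta.

Definition unital (mu : G -> H -> H) : Prop := forall v, mu gone v = v.

Definition D_ge (mu : G -> H -> H) (c : R) : Prop :=
  forall c', c' < c -> forall nu, is_hom nu -> ~ mapdist_le mu nu c'.

Definition D_le (mu : G -> H -> H) (c : R) : Prop :=
  forall c', c < c' -> exists nu, is_hom nu /\ mapdist_le mu nu c'.
End Ulam.

(* F_G(delta) >= c  (supremum over all Hilbert spaces H and all unital maps
   mu : G -> U(H) with def(mu) <= delta) *)
Definition F_ge (G : Group) (delta c : R) : Prop :=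
  forall c', c' < c -> exists (H : HilbertSpace) (mu : G -> H -> H),
    is_unitary_map mu /\ unital mu /\ defect_le mu delta /\ D_ge mu c'.

Definition F_le (G : Group) (delta c : R) : Prop :=
  forall (H : HilbertSpace) (mu : G -> H -> H),
    is_unitary_map mu -> unital mu -> defect_le mu delta -> D_le mu c.

(* def(G) = lim_{delta -> 0+} F_G(delta) = 0  (F_G >= 0) *)
Definition strongly_Ulam_stable (G : Group) : Prop :=
  forall eps, 0 < eps -> exists delta0, 0 < delta0 /\
    forall delta, 0 < delta < delta0 -> F_le G delta eps.

(* Main.v *)
From Stdlib Require Import Reals Lra Lia List Bool.
From Stdlib Require Import Classical ClassicalEpsilon.
From Stdlib Require Import FunctionalExtensionality PropExtensionality ProofIrrelevance.
Require Import Defs.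
Open Scope R_scope.

(** Let [L] be free on [a], [b] inside [G].  Counting occurrences of [ab] minus those
    of [b^-1 a^-1] in reduced words gives a quasimorphism [q] on [L] of defect at most
    3 with [q ([a,b]^n) = n].  Inducing [exp (i theta q)] from [L] to [G] yields a
    unital quasi-representation [mu] on [l2(G/L)] of defect at most [3 theta], under
    which the basis vector [xi] at the trivial coset is an eigenvector of [L].

    If a homomorphism [nu] is within [1/2] of [mu], the [nu(L)]-orbit of the line of
    [xi] is small in projective space, so it has a unique circumcentre: a line [C eta]
    fixed by [nu(L)] and close to [xi].  Being one-dimensional, it is fixed pointwise
    by commutators; but for [theta = pi/n], [mu ([a,b]^n)] acts on [xi] as [-1]. *)

(** * Counting quasimorphism on a free subgroup *)

(** The orbit of the vector [xi] under [nu] restricted to [L] is not small, because the phases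
    [theta * q] wind around the circle; only the orbit of its line is. [L] is not amenable, so no
    mean can produce a fixed line, and a circumcentre is used instead: it needs no average, only an
    overlap above 1/2, that is, an angle below 45 degrees. A distance c < 1/2 gives a real part of
    at least 1 - c^2/2 >= 7/8, hence an overlap of at least (7/8)^2 = 49/64. At [[a,b]^n] the
    operators [mu] and [nu] then disagree by 2 |<xi, eta>| >= 7/4 when tested against [eta], far
    more than c. The quasimorphism controls nothing outside [L]. Induction gets around this because
    the coset cocycle satisfies its identity exactly and takes values in [L], so the only defect is
    that of [q] on [L]. Since [q] is unbounded on powers of one commutator, the total phase pi is
    reached however small [theta] is; this is why the bound does not decay with the defect. *)

Section FreeGroup.
Context {G : Group}.
Implicit Types x y z : G.

Lemma gmul_cancel_l x y z : gmul x y = gmul x z -> y = z.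
Proof.
  intros E. rewrite <- (gmul_one_l G y), <- (gmul_one_l G z), <- (gmul_inv_l G x).
  now rewrite <- !gmul_assoc, E.
Qed.

Lemma ginv_unique x y : gmul x y = gone -> y = ginv x.
Proof. intros E. apply (gmul_cancel_l x). now rewrite E, gmul_inv_r. Qed.

Lemma ginv_inv x : ginv (ginv x) = x.
Proof. symmetry. apply ginv_unique, gmul_inv_l. Qed.

Lemma ginv_one : ginv (@gone G) = gone.
Proof. symmetry. apply ginv_unique, gmul_one_l. Qed.

Lemma gmul_inv_cancel_l x y : gmul (ginv x) (gmul x y) = y.
Proof. now rewrite gmul_assoc, gmul_inv_l, gmul_one_l. Qed.

Lemma gmul_inv_cancel_r x y : gmul x (gmul (ginv x) y) = y.
Proof. now rewrite gmul_assoc, gmul_inv_r, gmul_one_l. Qed.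

Lemma ginv_mul x y : ginv (gmul x y) = gmul (ginv y) (ginv x).
Proof.
  symmetry. apply ginv_unique.
  now rewrite <- gmul_assoc, gmul_inv_cancel_r, gmul_inv_r.
Qed.

Fixpoint gpow x (n : nat) : G :=
  match n with O => gone | S n => gmul x (gpow x n) end.

Definition gcomm x y : G := gmul x (gmul y (gmul (ginv x) (ginv y))).

Lemma eval_word_app {I : Type} (f : I -> G) u v :
  eval_word f (u ++ v) = gmul (eval_word f u) (eval_word f v).
Proof.
  induction u as [|[i s] u IH]; simpl; [now rewrite gmul_one_l|].
  now rewrite IH, gmul_assoc.
Qed.

(** * Inversion and free reduction of words *)

Definition word_inv {I : Type} (w : list (I * bool)) : list (I * bool) :=
  rev (map (fun l => (fst l, negb (snd l))) w).

Lemma word_inv_app {I : Type} (u v : list (I * bool)) :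
  word_inv (u ++ v) = word_inv v ++ word_inv u.
Proof. unfold word_inv. now rewrite map_app, rev_app_distr. Qed.

Lemma word_inv_involutive {I : Type} (w : list (I * bool)) : word_inv (word_inv w) = w.
Proof.
  unfold word_inv. rewrite <- map_rev, rev_involutive, map_map.
  rewrite <- (map_id w) at 2. apply map_ext. intros [i s]; simpl.
  now rewrite negb_involutive.
Qed.

Lemma eval_word_inv {I : Type} (f : I -> G) w :
  eval_word f (word_inv w) = ginv (eval_word f w).
Proof.
  induction w as [|[i s] w IH]; simpl; [now rewrite ginv_one|].
  change ((i, s) :: w) with (((i, s) :: nil) ++ w).
  rewrite word_inv_app, eval_word_app, IH, ginv_mul. f_equal. simpl.
  rewrite gmul_one_r. destruct s; simpl; [reflexivity|now rewrite ginv_inv].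
Qed.

Lemma reduced_word_tail {I : Type} (l : I * bool) w :
  reduced_word (l :: w) -> reduced_word w.
Proof. destruct l, w as [|[]]; simpl; tauto. Qed.

Lemma reduced_word_app_l {I : Type} (u v : list (I * bool)) :
  reduced_word (u ++ v) -> reduced_word u.
Proof.
  induction u as [|[i s] u IH]; [easy|]. destruct u as [|[j t] u]; [easy|].
  simpl in *. tauto.
Qed.

Lemma reduced_word_glue {I : Type} (u v : list (I * bool)) i s j t :
  reduced_word (u ++ (i, s) :: nil) -> reduced_word ((j, t) :: v) ->
  ~ (i = j /\ s <> t) -> reduced_word (u ++ (i, s) :: (j, t) :: v).
Proof.
  intros Hu Hv Hn. induction u as [|[k r] u IH]; [now split|].
  destruct u as [|[k' r'] u]; simpl in *; tauto.
Qed.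

Lemma reduced_word_inv {I : Type} (w : list (I * bool)) :
  reduced_word w -> reduced_word (word_inv w).
Proof.
  induction w as [|[i s] w IH]; [easy|]. destruct w as [|[j t] w]; [easy|].
  intros [Hn Hr]. change (word_inv ((i, s) :: (j, t) :: w)) with
    ((word_inv w ++ (j, negb t) :: nil) ++ (i, negb s) :: nil).
  rewrite <- app_assoc. apply reduced_word_glue; [exact (IH Hr)|easy|].
  intros [-> E]. apply Hn. split; [easy|]. congruence.
Qed.

(** Cancellation in a product of reduced words happens only at the junction: as long as the last
    letter of [u] and the first of [v] are inverse, both move into [p]. The resulting three-legged
    shape ([u'], [p], [v']) is what the defect estimate uses. *)
Lemma reduced_cancellation {I : Type} (u v : list (I * bool)) :
  reduced_word u -> reduced_word v ->
  exists u' p v', u = u' ++ p /\ v = word_inv p ++ v' /\ reduced_word (u' ++ v').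
Proof.
  revert v. induction u as [|[i s] u IH] using rev_ind; intros v Hu Hv.
  - now exists nil, nil, v.
  - destruct v as [|[j t] v].
    + exists (u ++ (i, s) :: nil), nil, nil. now rewrite !app_nil_r.
    + destruct (classic (i = j /\ s <> t)) as [[-> Hst]|Hn].
      * destruct (IH v) as (u' & p & v' & -> & -> & Hr);
          [now apply reduced_word_app_l in Hu|now apply reduced_word_tail in Hv|].
        exists u', (p ++ (j, s) :: nil), v'. split; [now rewrite app_assoc|].
        split; [|easy]. rewrite word_inv_app. simpl.
        replace t with (negb s); [easy|]. destruct s, t; tauto.
      * exists (u ++ (i, s) :: nil), nil, ((j, t) :: v).
        rewrite app_nil_r, <- app_assoc. split; [easy|split; [easy|]].
        now apply reduced_word_glue.
Qed.

Lemma reduced_word_exists {I : Type} (f : I -> G) w :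
  exists r, reduced_word r /\ eval_word f r = eval_word f w.
Proof.
  induction w as [|[i s] w (r & Hr & E)]; [now exists nil|].
  destruct (reduced_cancellation ((i, s) :: nil) r) as (u & p & v & Eu & Ev & Huv);
    [easy|easy|].
  exists (u ++ v). split; [easy|].
  change ((i, s) :: w) with (((i, s) :: nil) ++ w).
  rewrite (eval_word_app f _ w), <- E, Eu, Ev, !eval_word_app, eval_word_inv.
  now rewrite <- gmul_assoc, gmul_inv_cancel_r.
Qed.

(** Reducing the product of [word_inv u] and [v] leaves a reduced word of value 1, which freeness
    forces to be empty. *)
Lemma free_family_inj {I : Type} (f : I -> G) u v :
  free_family f -> reduced_word u -> reduced_word v ->
  eval_word f u = eval_word f v -> u = v.
Proof.
  intros Hf Hu Hv E.
  destruct (reduced_cancellation (word_inv u) v) as (u' & p & v' & Eu & Ev & Hr);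
    [now apply reduced_word_inv|easy|].
  assert (E1 : eval_word f (u' ++ v') = gone).
  { transitivity (gmul (eval_word f (word_inv u)) (eval_word f v)).
    - rewrite Eu, Ev, !eval_word_app, eval_word_inv.
      now rewrite <- gmul_assoc, gmul_inv_cancel_r.
    - now rewrite eval_word_inv, E, gmul_inv_l. }
  assert (E2 : u' ++ v' = nil).
  { apply NNPP. intros Hn. now apply (Hf (u' ++ v')). }
  apply app_eq_nil in E2 as [-> ->].
  rewrite <- (word_inv_involutive u), Eu, Ev. simpl. now rewrite app_nil_r.
Qed.

(** Serves to restrict an arbitrary basis to two of its elements, so that words over [bool]
    suffice. *)
Lemma free_family_comp {I J : Type} (f : I -> G) (h : J -> I) :
  (forall j k, h j = h k -> j = k) -> free_family f -> free_family (fun j => f (h j)).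
Proof.
  intros Hh Hf w Hw Hr E.
  apply (Hf (map (fun l => (h (fst l), snd l)) w)).
  - now destruct w.
  - clear E Hw. induction w as [|[i s] w IH]; [easy|]. destruct w as [|[j t] w]; [easy|].
    simpl in *. split; [|tauto]. intros [Eh Hst]. apply Hh in Eh. tauto.
  - rewrite <- E. clear. induction w as [|[i s] w IH]; [easy|]. simpl. now rewrite IH.
Qed.

(* With [a] indexed by [true] and [b] by [false], this counts [ab] positively and
   its inverse [b^-1 a^-1] negatively. *)
Definition pair_weight (l m : bool * bool) : R :=
  match l, m with
  | (true, true), (false, true) => 1
  | (false, false), (true, false) => -1
  | _, _ => 0
  end.

Fixpoint pair_count (w : list (bool * bool)) : R :=
  match w with
  | l :: ((m :: _) as w') => pair_weight l m + pair_count w'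
  | _ => 0
  end.

(** Only the pair straddling the junction is missing from the two separate counts, and its weight is
    -1, 0 or 1. *)
Lemma pair_count_app (u v : list (bool * bool)) :
  Rabs (pair_count (u ++ v) - pair_count u - pair_count v) <= 1.
Proof.
  induction u as [|l u IH].
  - simpl. rewrite Rabs_pos_eq; lra.
  - destruct u as [|m u].
    + destruct v as [|k v]; simpl; [rewrite Rabs_pos_eq; lra|].
      match goal with |- Rabs ?e <= 1 =>
        replace e with (pair_weight l k) by ring end.
      destruct l as [[] []], k as [[] []]; simpl; apply Rabs_le; lra.
    + change (pair_count ((l :: m :: u) ++ v))
        with (pair_weight l m + pair_count ((m :: u) ++ v)).
      change (pair_count (l :: m :: u)) with (pair_weight l m + pair_count (m :: u)).
      match goal with |- Rabs ?e <= 1 =>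
        replace e with (pair_count ((m :: u) ++ v) - pair_count (m :: u) - pair_count v)
          by ring end.
      exact IH.
Qed.

Lemma pair_count_rcons u l m :
  pair_count (u ++ l :: m :: nil) = pair_count (u ++ l :: nil) + pair_weight l m.
Proof.
  induction u as [|k u IH]; simpl; [ring|].
  destruct u as [|k' u]; simpl in *; rewrite IH; ring.
Qed.

(** Inversion turns the pair (l, m) into (m^-1, l^-1), which exchanges the two counted patterns.
    This antisymmetry lets the cancelled part of a product drop out of the defect. *)
Lemma pair_count_inv w : pair_count (word_inv w) = - pair_count w.
Proof.
  induction w as [|l w IH]; [simpl; ring|]. destruct w as [|m w]; [simpl; ring|].
  change (word_inv (l :: m :: w)) with
    ((word_inv w ++ (fst m, negb (snd m)) :: nil) ++ (fst l, negb (snd l)) :: nil).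
  rewrite <- app_assoc. simpl app. rewrite pair_count_rcons.
  change (word_inv w ++ (fst m, negb (snd m)) :: nil) with (word_inv (m :: w)).
  rewrite IH. simpl pair_count.
  destruct l as [[] []], m as [[] []]; simpl; ring.
Qed.

Fixpoint comm_word (n : nat) : list (bool * bool) :=
  match n with
  | O => nil
  | S n => (true, true) :: (false, true) :: (true, false) :: (false, false) :: comm_word n
  end.

Lemma comm_word_reduced n : reduced_word (comm_word n).
Proof.
  induction n as [|n IH]; [easy|].
  destruct n as [|n]; simpl in *; repeat split; intuition congruence.
Qed.

(** Each block a b a^-1 b^-1 contributes its initial ab; the pairs b a^-1 and a^-1 b^-1, and the
    junction b^-1 a of consecutive blocks, have weight 0. *)
Lemma comm_word_count n : pair_count (comm_word n) = INR n.
Proof.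
  induction n as [|n IH]; [easy|]. rewrite S_INR, <- IH.
  destruct n as [|n]; simpl; ring.
Qed.

Lemma comm_word_eval (f : bool -> G) n :
  eval_word f (comm_word n) = gpow (gcomm (f true) (f false)) n.
Proof.
  induction n as [|n IH]; [easy|]. simpl. rewrite IH. unfold gcomm.
  now rewrite !gmul_assoc.
Qed.

Definition is_subgroup (L : G -> Prop) : Prop :=
  L gone /\ (forall x y, L x -> L y -> L (gmul x y)) /\ (forall x, L x -> L (ginv x)).

Lemma free_subgroup_quasimorphism :
  has_nonabelian_free_subgroup G ->
  exists (L : G -> Prop) (q : G -> R) (a b : G),
    is_subgroup L /\ L a /\ L b /\ q gone = 0 /\
    (forall x y, L x -> L y -> Rabs (q (gmul x y) - q x - q y) <= 3) /\
    (forall n, q (gpow (gcomm a b) n) = INR n).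
Proof.
  intros (I & f0 & Hf0 & i & j & Hij).
  set (f := fun k : bool => f0 (if k then i else j)).
  assert (Hf : free_family f).
  { apply (free_family_comp f0 (fun k : bool => if k then i else j)); [|easy].
    intros [] []; congruence. }
  set (P := fun x (w : list (bool * bool)) => reduced_word w /\ eval_word f w = x).
  (* Off the subgroup generated by [f] the chosen word, hence [q], is arbitrary; on it the word is
     the unique reduced one. *)
  set (q := fun x => pair_count (epsilon (inhabits nil) (P x))).
  assert (Hq : forall w, reduced_word w -> q (eval_word f w) = pair_count w).
  { intros w Hw. unfold q. f_equal.
    destruct (epsilon_spec (inhabits nil) (P (eval_word f w))) as [Hr E];
      [now exists w|].
    now apply (free_family_inj f). }
  exists (fun x => exists w, eval_word f w = x), q, (f true), (f false).
  repeat apply conj.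
  - now exists nil.
  - intros x y [u <-] [v <-]. exists (u ++ v). apply eval_word_app.
  - intros x [u <-]. exists (word_inv u). apply eval_word_inv.
  - exists ((true, true) :: nil). simpl. apply gmul_one_r.
  - exists ((false, true) :: nil). simpl. apply gmul_one_r.
  - exact (Hq nil Logic.I).
  - intros x y [u0 <-] [v0 <-].
    destruct (reduced_word_exists f u0) as (u & Hu & <-).
    destruct (reduced_word_exists f v0) as (v & Hv & <-).
    destruct (reduced_cancellation u v) as (u' & p & v' & Eu & Ev & Hr); [easy|easy|].
    replace (gmul (eval_word f u) (eval_word f v)) with (eval_word f (u' ++ v')).
    2:{ rewrite Eu, Ev, !eval_word_app, eval_word_inv.
        now rewrite <- gmul_assoc, gmul_inv_cancel_r. }
    rewrite !Hq by easy. rewrite Eu, Ev.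
    (* One unit of error for each pair of legs of the tripod gives the constant 3; the counts of [p]
       and [word_inv p] cancel. *)
    pose proof (pair_count_app u' v') as H1.
    pose proof (pair_count_app u' p) as H2.
    pose proof (pair_count_app (word_inv p) v') as H3.
    rewrite pair_count_inv in H3.
    unfold Rabs in *. repeat destruct Rcase_abs; lra.
  - intros n. now rewrite <- comm_word_eval, Hq, comm_word_count by apply comm_word_reduced.
Qed.

End FreeGroup.

(** * A line fixed by a unitary group with a small projective orbit *)

Definition Cnsq (a : Cx) : R := Cre a * Cre a + Cim a * Cim a.

Lemma Cx_eq (a b : Cx) : Cre a = Cre b -> Cim a = Cim b -> a = b.
Proof. destruct a, b; simpl; congruence. Qed.

Ltac cx := intros; apply Cx_eq; simpl; ring.

Lemma Cnsq_ge0 a : 0 <= Cnsq a.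
Proof. unfold Cnsq. nra. Qed.

Lemma Cnsq_mul a b : Cnsq (Cmul a b) = Cnsq a * Cnsq b.
Proof. unfold Cnsq; simpl; ring. Qed.

Lemma Cnsq_conj a : Cnsq (Cconj a) = Cnsq a.
Proof. unfold Cnsq; simpl; ring. Qed.

Lemma Un_cv_lower_bound (a : nat -> R) (l t : R) (N : nat) :
  Un_cv a l -> (forall n, (N <= n)%nat -> t <= a n) -> t <= l.
Proof.
  intros Ha Ht. destruct (Rle_or_lt t l) as [|Hlt]; [easy|].
  destruct (Ha (t - l)) as [M HM]; [lra|].
  specialize (HM (max N M) (Nat.le_max_r _ _)). specialize (Ht (max N M) (Nat.le_max_l _ _)).
  unfold Rdist in HM. rewrite Rabs_pos_eq in HM; lra.
Qed.

Lemma Rabs_sqr_le (x y : R) : 0 <= y -> x * x <= y * y -> Rabs x <= y.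
Proof. intros Hy Hxy. apply Rabs_le. split; nra. Qed.

Lemma inv_nat_small (eps : R) : 0 < eps -> exists N : nat, / INR (S N) < eps.
Proof.
  intros He. destruct (archimed_cor1 eps He) as (N & HN & PN). exists N.
  eapply Rle_lt_trans; [|exact HN]. apply Rinv_le_contravar.
  - now apply lt_0_INR.
  - apply le_INR. lia.
Qed.

Lemma Un_cv_const (c : R) : Un_cv (fun _ => c) c.
Proof. intros eps He. exists O. intros. unfold Rdist. now rewrite Rminus_diag, Rabs_R0. Qed.

(** * Hilbert space geometry and circumcentres of sets of lines *)

Section Hilbert.
Context {H : HilbertSpace}.
Implicit Types u v w e : H.

Definition nsq u : R := Cre (inner u u).

Lemma hadd_cancel_l u v w : hadd u v = hadd u w -> v = w.
Proof.
  intros E. rewrite <- (hadd_zero H v), <- (hadd_zero H w), <- (hadd_opp H u).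
  now rewrite !(hadd_assoc H), !(hadd_comm H _ u), E.
Qed.

Lemma hscal_zero u : hscal C0 u = hzero.
Proof.
  apply (hadd_cancel_l (hscal C0 u)). rewrite <- hscal_distr_scal, hadd_zero.
  f_equal. cx.
Qed.

Lemma hopp_scal u : hopp u = hscal (mkC (-1) 0) u.
Proof.
  apply (hadd_cancel_l u). rewrite hadd_opp.
  rewrite <- (hscal_one H u) at 1. rewrite <- hscal_distr_scal.
  rewrite <- (hscal_zero u). f_equal. cx.
Qed.

Lemma hsub_eq0 u v : hsub u v = hzero -> u = v.
Proof.
  unfold hsub. intros E. apply (hadd_cancel_l (hopp v)).
  now rewrite (hadd_comm H _ u), E, (hadd_comm H _ v), hadd_opp.
Qed.

Lemma inner_add_r u v w : inner u (hadd v w) = Cadd (inner u v) (inner u w).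
Proof.
  rewrite (inner_conj_sym H (hadd v w) u), inner_add_l.
  rewrite (inner_conj_sym H v u), (inner_conj_sym H w u). cx.
Qed.

Lemma inner_scal_r a u v : inner u (hscal a v) = Cmul (Cconj a) (inner u v).
Proof.
  rewrite (inner_conj_sym H (hscal a v) u), inner_scal_l.
  rewrite (inner_conj_sym H v u). cx.
Qed.

Lemma inner_self_im u : Cim (inner u u) = 0.
Proof. pose proof (f_equal Cim (inner_conj_sym H u u)) as E. simpl in E. lra. Qed.

Lemma inner_sym_re u v : Cre (inner v u) = Cre (inner u v).
Proof. now rewrite (inner_conj_sym H u v). Qed.

Lemma inner_sym_im u v : Cim (inner v u) = - Cim (inner u v).
Proof. now rewrite (inner_conj_sym H u v). Qed.

Lemma inner_zero_l u : inner hzero u = C0.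
Proof. rewrite <- (hscal_zero hzero), inner_scal_l. cx. Qed.

Ltac expand := unfold nsq, hsub;
  rewrite ?hopp_scal, ?inner_add_l, ?inner_add_r, ?inner_scal_l, ?inner_scal_r,
          ?inner_add_l, ?inner_add_r, ?inner_scal_l, ?inner_scal_r.

Lemma nsq_ge0 u : 0 <= nsq u.
Proof. apply inner_pos. Qed.

Lemma nsq_scal a u : nsq (hscal a u) = Cnsq a * nsq u.
Proof. expand. simpl. rewrite inner_self_im. unfold Cnsq. ring. Qed.

Lemma nsq_sub u v : nsq (hsub u v) = nsq u + nsq v - 2 * Cre (inner u v).
Proof. expand. simpl. rewrite (inner_sym_re u v). ring. Qed.

Lemma nsq_add u v : nsq (hadd u v) = nsq u + nsq v + 2 * Cre (inner u v).
Proof. expand. simpl. rewrite (inner_sym_re u v). ring. Qed.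

Lemma nsq_sub_eq u v : nsq (hsub u v) <= 0 -> u = v.
Proof.
  intros E. apply hsub_eq0, inner_definite. fold (nsq (hsub u v)).
  pose proof (nsq_ge0 (hsub u v)). lra.
Qed.

(** By the parallelogram law the gap between the two sides is |u + w - 2v|^2. *)
Lemma nsq_sub_triangle u v w :
  nsq (hsub u w) <= 2 * nsq (hsub u v) + 2 * nsq (hsub v w).
Proof.
  pose proof (nsq_ge0 (hsub (hadd u w) (hscal (mkC 2 0) v))) as P.
  rewrite nsq_sub, nsq_add, nsq_scal, inner_add_l, !inner_scal_r in P.
  rewrite !nsq_sub. unfold Cnsq in P. simpl in P.
  rewrite (inner_sym_re v w) in P. lra.
Qed.

Lemma hnorm_ge0 u : 0 <= hnorm u.
Proof. apply sqrt_pos. Qed.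

Lemma hnorm_sqr u : hnorm u * hnorm u = nsq u.
Proof. apply sqrt_sqrt, inner_pos. Qed.

(* Bessel's inequality, cleared of denominators. *)
Lemma bessel2 e s d :
  inner s d = C0 -> 0 < nsq s -> 0 < nsq d ->
  Cnsq (inner e s) * nsq d + Cnsq (inner e d) * nsq s <= nsq e * nsq s * nsq d.
Proof.
  intros O Ps Pd.
  pose proof (nsq_ge0 (hsub (hscal (mkC (nsq s * nsq d) 0) e)
    (hadd (hscal (Cmul (mkC (nsq d) 0) (inner e s)) s)
          (hscal (Cmul (mkC (nsq s) 0) (inner e d)) d)))) as P.
  rewrite nsq_sub, nsq_add, !nsq_scal, inner_add_r, !inner_scal_l, !inner_scal_r, O in P.
  unfold Cnsq in *. simpl in P.
  set (A := nsq s) in *. set (B := nsq d) in *. set (E := nsq e) in *.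
  set (p := Cre (inner e s)) in *. set (p' := Cim (inner e s)) in *.
  set (r := Cre (inner e d)) in *. set (r' := Cim (inner e d)) in *.
  assert (P2 : 0 <= (A * B) * (E * A * B - ((p * p + p' * p') * B + (r * r + r' * r') * A))).
  { eapply Rle_trans; [exact P|]. right. ring. }
  assert (0 < A * B) by nra.
  destruct (Rle_or_lt 0 (E * A * B - ((p * p + p' * p') * B + (r * r + r' * r') * A)));
    [lra|nra].
Qed.

Lemma cauchy_schwarz u v : Cnsq (inner u v) <= nsq u * nsq v.
Proof.
  destruct (Rle_lt_or_eq_dec 0 (nsq v) (nsq_ge0 v)) as [Pv|Pv].
  - pose proof (nsq_ge0 (hsub (hscal (mkC (nsq v) 0) u) (hscal (inner u v) v))) as P.
    rewrite nsq_sub, !nsq_scal, inner_scal_l, inner_scal_r in P.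
    unfold Cnsq in *; simpl in P.
    set (A := nsq v) in *. set (p := Cre (inner u v)) in *. set (p' := Cim (inner u v)) in *.
    assert (0 <= A * (nsq u * A - (p * p + p' * p'))).
    { eapply Rle_trans; [exact P|]. right. ring. }
    destruct (Rle_or_lt 0 (nsq u * A - (p * p + p' * p'))); [lra|nra].
  - assert (v = hzero) as -> by now apply inner_definite.
    rewrite (inner_conj_sym H hzero u), inner_zero_l, <- Pv. unfold Cnsq; simpl. lra.
Qed.

Lemma phase_alignment u v :
  exists z, Cnsq z = 1 /\ 0 <= Cre (inner u (hscal z v)) /\ Cim (inner u (hscal z v)) = 0.
Proof.
  set (w := inner u v). destruct (Rle_lt_or_eq_dec 0 (Cnsq w) (Cnsq_ge0 w)) as [P|P].
  - set (m := sqrt (Cnsq w)). assert (Pm : 0 < m) by now apply sqrt_lt_R0.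
    assert (Em : m * m = Cnsq w) by (apply sqrt_sqrt; lra).
    (* [inner] is conjugate-linear in its second argument, so the phase of [w] itself, not its
       conjugate, makes the product positive. *)
    exists (mkC (Cre w / m) (Cim w / m)). rewrite inner_scal_r. fold w.
    unfold Cnsq in *. simpl. repeat split.
    + replace (Cre w / m * (Cre w / m) + Cim w / m * (Cim w / m))
        with ((Cre w * Cre w + Cim w * Cim w) / (m * m)) by (field; lra).
      rewrite <- Em. field. lra.
    + replace (Cre w / m * Cre w - - (Cim w / m) * Cim w)
        with ((Cre w * Cre w + Cim w * Cim w) / m) by (field; lra).
      rewrite <- Em. replace (m * m / m) with m by (field; lra). lra.
    + field. lra.
  - exists C1. rewrite hscal_one. fold w. unfold Cnsq in *. simpl.
    repeat split; nra.
Qed.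

(** For unit vectors the overlap is the squared cosine of the angle between the two lines, so the
    best [t] measures the radius of the set of lines [e k] seen from [eta]. A threshold avoids
    forming an infimum over [K]. *)
Definition overlap_ge {K : Type} (e : K -> H) (eta : H) (t : R) : Prop :=
  forall k, t <= Cnsq (inner (e k) eta).

Lemma overlap_ge_phase {K : Type} (e : K -> H) eta z t :
  Cnsq z = 1 -> overlap_ge e eta t -> overlap_ge e (hscal z eta) t.
Proof.
  intros Hz Ho k. rewrite inner_scal_r, Cnsq_mul, Cnsq_conj, Hz, Rmult_1_l. apply Ho.
Qed.

(* The normalised midpoint of two vectors with overlap [t > 1/2] has a larger
   overlap, which bounds their distance by the room left below the supremum [r]. *)
Lemma overlap_midpoint {K : Type} (e : K -> H) (r t : R) (u v : H) :
  (forall k, nsq (e k) = 1) ->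
  (forall eta s, nsq eta = 1 -> overlap_ge e eta s -> s <= r) ->
  nsq u = 1 -> nsq v = 1 -> 1/2 < t -> overlap_ge e u t -> overlap_ge e v t ->
  0 <= Cre (inner u v) -> Cim (inner u v) = 0 ->
  nsq (hsub u v) * (2 * r - 1) <= 4 * (r - t).
Proof.
  intros He Hr Hu Hv Ht Ou Ov Pre Pim.
  assert (Htr : t <= r) by now apply (Hr u).
  set (D := nsq (hsub u v)).
  assert (ED : D = 2 - 2 * Cre (inner u v)) by (unfold D; rewrite nsq_sub; lra).
  set (s := hadd u v).
  assert (Es : nsq s = 4 - D) by (unfold s; rewrite nsq_add; lra).
  assert (PD : 0 <= D) by apply nsq_ge0.
  destruct (Rle_lt_or_eq_dec 0 D PD) as [PD'|<-]; [|lra].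
  (* Sum and difference are orthogonal because [u] and [v] have equal norms and a real inner
     product. *)
  assert (O : inner s (hsub u v) = C0).
  { unfold s, hsub. rewrite hopp_scal, inner_add_l, !inner_add_r, !inner_scal_r.
    apply Cx_eq; simpl; rewrite ?(inner_sym_re u v), ?(inner_sym_im u v), ?inner_self_im;
      fold (nsq u); fold (nsq v); lra. }
  (* Write x and y for the squared products of [e k] with [s] and [hsub u v]. The parallelogram law
     gives x + y >= 4t, Bessel gives xD + y(4 - D) <= D(4 - D); eliminating y yields the bound. *)
  assert (Key : forall k, (4 * t - D) * (4 - D) <= Cnsq (inner (e k) s) * (4 - 2 * D)).
  { intros k.
    pose proof (bessel2 (e k) s (hsub u v) O ltac:(lra) PD') as B.
    fold D in B. rewrite He, Es in B.
    assert (PL : 4 * t <= Cnsq (inner (e k) s) + Cnsq (inner (e k) (hsub u v))).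
    { specialize (Ou k). specialize (Ov k). unfold s, hsub.
      rewrite hopp_scal, !inner_add_r, inner_scal_r. unfold Cnsq in *; simpl. lra. }
    nra. }
  (* Over an empty [K] every threshold would be an overlap, contradicting the bound [r]. *)
  assert (K0 : exists k : K, True).
  { apply NNPP. intros Hn. enough (r + 1 <= r) by lra.
    apply (Hr u); [easy|]. intros k. exfalso. eauto. }
  (* The nonnegative real part gives D <= 2; equality would make the right side of [Key] vanish,
     against t > 1/2. *)
  assert (D2 : D < 2).
  { destruct K0 as [k _]. specialize (Key k).
    pose proof (Cnsq_ge0 (inner (e k) s)). nra. }
  assert (Pn : 0 < 4 - 2 * D) by lra.
  enough (Hle : (4 * t - D) / (4 - 2 * D) <= r).
  { apply (Rmult_le_compat_r (4 - 2 * D)) in Hle; [|lra].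
    unfold Rdiv in Hle. rewrite Rmult_assoc, Rinv_l in Hle by lra. lra. }
  set (m := / sqrt (4 - D)).
  assert (Em : m * m * (4 - D) = 1).
  { assert (Q : sqrt (4 - D) * sqrt (4 - D) = 4 - D) by (apply sqrt_sqrt; lra).
    assert (0 < sqrt (4 - D)) by (apply sqrt_lt_R0; lra).
    rewrite <- Q. unfold m. field. lra. }
  apply (Hr (hscal (mkC m 0) s)).
  - rewrite nsq_scal, Es. unfold Cnsq; simpl. lra.
  - intros k. rewrite inner_scal_r, Cnsq_mul. specialize (Key k).
    apply (Rmult_le_reg_r (4 - 2 * D)); [lra|]. unfold Rdiv.
    rewrite Rmult_assoc, Rinv_l by lra. unfold Cnsq at 1; simpl.
    apply (Rmult_le_compat_l (m * m)) in Key; [|nra].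
    replace (m * m * ((4 * t - D) * (4 - D))) with ((4 * t - D) * (m * m * (4 - D))) in Key by ring.
    rewrite Em in Key. nra.
Qed.

(** The midpoint estimate sees vectors only up to phase. If both have nonnegative real product with
    [e], the phase [z] is itself near 1: testing against [e] gives 1 - Re z <= 4 kappa, and then 2
    kappa + 4 (1 - Re z) <= 18 kappa. *)
Lemma overlap_phase_dist (e u v : H) (kappa : R) (z : Cx) :
  nsq e = 1 -> nsq v = 1 -> Cnsq z = 1 ->
  1/2 < Cnsq (inner e v) ->
  0 <= Cre (inner e u) -> Cim (inner e u) = 0 ->
  0 <= Cre (inner e v) -> Cim (inner e v) = 0 ->
  nsq (hsub u (hscal z v)) <= kappa ->
  nsq (hsub u v) <= 18 * kappa.
Proof.
  intros He Hv Hz Hev Pu Iu Pv Iv Hk.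
  set (p := Cre (inner e u)) in *. set (q := Cre (inner e v)) in *.
  assert (C : Cnsq (inner e (hsub u (hscal z v))) <= kappa).
  { eapply Rle_trans; [apply cauchy_schwarz|]. rewrite He. lra. }
  unfold hsub in C. rewrite hopp_scal, inner_add_r, !inner_scal_r in C.
  unfold Cnsq in C, Hev, Hz. simpl in C. fold p q in C. fold q in Hev.
  rewrite Iu, Iv in C. rewrite Iv in Hev.
  assert (Hz1 : (1 - Cre z) <= 4 * kappa).
  { set (x := Cre z) in *. set (y := Cim z) in *.
    assert (E : p * p + q * q * (x * x + y * y) - 2 * p * q * x <= kappa).
    { eapply Rle_trans; [|exact C]. right. ring. }
    rewrite Hz in E. assert (x <= 1) by nra. assert (-1 <= x) by nra.
    assert (0 <= p * q) by nra.
    assert (q * q * (1 - x) <= 2 * kappa).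
    { assert (0 <= (1 + x) * ((p - q) * (p - q)))
        by (apply Rmult_le_pos; [lra|apply Rle_0_sqr]).
      assert (0 <= (p * q) * (1 - x)) by (apply Rmult_le_pos; lra).
      assert (0 <= p * p * (1 - x)) by (apply Rmult_le_pos; [apply Rle_0_sqr|lra]).
      lra. }
    nra. }
  eapply Rle_trans; [apply (nsq_sub_triangle u (hscal z v) v)|].
  assert (Ez : nsq (hsub (hscal z v) v) = 2 * (1 - Cre z)).
  { rewrite nsq_sub, nsq_scal, inner_scal_l. simpl. rewrite inner_self_im.
    fold (nsq v). unfold Cnsq. rewrite Hv, Hz. ring. }
  rewrite Ez. lra.
Qed.

Definition hcv (s : nat -> H) (l : H) : Prop :=
  forall eps, 0 < eps -> exists N, forall n, (N <= n)%nat -> hnorm (hsub (s n) l) < eps.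

Lemma hcv_inner e s l :
  hcv s l -> Un_cv (fun n => Cre (inner e (s n))) (Cre (inner e l)) /\
             Un_cv (fun n => Cim (inner e (s n))) (Cim (inner e l)).
Proof.
  intros Hs.
  assert (Key : forall n, Cnsq (inner e (hsub (s n) l)) <=
            (hnorm e * hnorm (hsub (s n) l)) * (hnorm e * hnorm (hsub (s n) l))).
  { intros n. eapply Rle_trans; [apply cauchy_schwarz|]. rewrite <- !hnorm_sqr. lra. }
  assert (Pe : 0 <= hnorm e) by apply sqrt_pos.
  split; intros eps Heps;
    (destruct (Hs (eps / (hnorm e + 1))) as [N HN]; [apply Rdiv_lt_0_compat; lra|]);
    exists N; intros n Hn; specialize (HN n Hn); specialize (Key n);
    assert (Pd : 0 <= hnorm (hsub (s n) l)) by apply sqrt_pos;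
    (apply (Rmult_lt_compat_r (hnorm e + 1)) in HN; [|lra]);
    unfold Rdiv in HN; rewrite Rmult_assoc, Rinv_l, Rmult_1_r in HN by lra;
    (eapply Rle_lt_trans; [|exact HN]); unfold Rdist;
    (apply Rle_trans with (hnorm e * hnorm (hsub (s n) l)); [|nra]);
    (apply Rabs_sqr_le; [nra|]); (eapply Rle_trans; [|exact Key]);
    unfold hsub, Cnsq; rewrite hopp_scal, inner_add_r, inner_scal_r; simpl;
    [pose proof (Rle_0_sqr (Cim (inner e (s n)) - Cim (inner e l))) as Q
    |pose proof (Rle_0_sqr (Cre (inner e (s n)) - Cre (inner e l))) as Q];
    unfold Rsqr in Q; lra.
Qed.

(** Expanding the square, |s_n - l|^2 tends to c - |l|^2, and also to 0. *)
Lemma hcv_nsq s l c : hcv s l -> (forall n, nsq (s n) = c) -> nsq l = c.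
Proof.
  intros Hs Hc.
  assert (Cv : Un_cv (fun n => nsq (hsub (s n) l)) (c + nsq l - 2 * nsq l)).
  { apply (Un_cv_ext (fun n => c + nsq l - 2 * Cre (inner l (s n)))).
    - intros n. now rewrite nsq_sub, Hc, (inner_sym_re l (s n)).
    - apply (CV_minus (fun _ => c + nsq l)).
      + apply Un_cv_const.
      + apply (CV_mult (fun _ => 2)).
        * apply Un_cv_const.
        * now apply hcv_inner. }
  assert (C0' : Un_cv (fun n => nsq (hsub (s n) l)) 0).
  { intros eps He. destruct (Hs (Rmin eps 1)) as [N HN]; [apply Rmin_pos; lra|].
    exists N. intros n Hn. specialize (HN n Hn). unfold Rdist.
    rewrite Rminus_0_r, Rabs_pos_eq by apply nsq_ge0. rewrite <- hnorm_sqr.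
    pose proof (hnorm_ge0 (hsub (s n) l)).
    pose proof (Rmin_l eps 1). pose proof (Rmin_r eps 1). nra. }
  pose proof (UL_sequence _ _ _ Cv C0'). lra.
Qed.

(** The midpoint estimate plays the role of uniform convexity: a maximising sequence, with phases
    fixed against [e k0], is Cauchy, and completeness replaces compactness. *)
Lemma overlap_maximizer {K : Type} (e : K -> H) (k0 : K) (rho : R) (xi : H) :
  (forall k, nsq (e k) = 1) -> nsq xi = 1 -> 1/2 < rho -> overlap_ge e xi rho ->
  exists eta r, nsq eta = 1 /\ rho <= r /\ overlap_ge e eta r /\
    (forall eta' s, nsq eta' = 1 -> overlap_ge e eta' s -> s <= r).
Proof.
  intros He Hxi Hrho Oxi.
  set (E := fun t => exists eta, nsq eta = 1 /\ overlap_ge e eta t).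
  destruct (completeness E) as [r [Hub Hlub]].
  { exists 1. intros t (eta & Heta & Ho). eapply Rle_trans; [apply (Ho k0)|].
    eapply Rle_trans; [apply cauchy_schwarz|]. rewrite He, Heta. lra. }
  { exists rho. now exists xi. }
  assert (Hmax : forall eta' s, nsq eta' = 1 -> overlap_ge e eta' s -> s <= r)
    by (intros eta' s H1 H2; apply Hub; now exists eta').
  assert (Hr : rho <= r) by now apply (Hmax xi).
  (* The gap is proportional to r - 1/2, so the factor 2r - 1 in [overlap_midpoint] cancels and
     leaves a squared distance of 2/(N + 2). The denominator n + 2 keeps the threshold strictly
     above 1/2 already at n = 0. *)
  set (t := fun n : nat => r - (r - 1/2) * / INR (S (S n))).
  assert (Pinv : forall n, 0 < / INR (S (S n)) <= 1/2).
  { intros n. pose proof (pos_INR n). rewrite !S_INR. split.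
    - apply Rinv_0_lt_compat. lra.
    - replace (1/2) with (/ 2) by lra. apply Rinv_le_contravar; lra. }
  assert (Ht : forall n, 1/2 < t n < r).
  { intros n. specialize (Pinv n). unfold t. nra. }
  assert (Hex : forall n, exists eta, nsq eta = 1 /\ overlap_ge e eta (t n) /\
    0 <= Cre (inner (e k0) eta) /\ Cim (inner (e k0) eta) = 0).
  { intros n.
    assert (exists eta, nsq eta = 1 /\ overlap_ge e eta (t n)) as (eta & Heta & Ho).
    { apply NNPP. intros Hn. enough (r <= t n) by (specialize (Ht n); lra).
      apply Hlub. intros x (eta & Heta & Ho). destruct (Rle_or_lt x (t n)); [easy|].
      exfalso. apply Hn. exists eta. split; [easy|]. intros k. specialize (Ho k). lra. }
    destruct (phase_alignment (e k0) eta) as (z & Hz & Hre & Him).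
    exists (hscal z eta). split; [rewrite nsq_scal, Hz; lra|].
    split; [now apply overlap_ge_phase|easy]. }
  apply choice in Hex as [s Hs].
  assert (Ov : forall N n, (N <= n)%nat -> overlap_ge e (s n) (t N)).
  { intros N n Hn k. destruct (Hs n) as (_ & Ho & _). eapply Rle_trans; [|apply Ho].
    unfold t. enough (/ INR (S (S n)) <= / INR (S (S N))) by nra.
    apply Rinv_le_contravar; [apply lt_0_INR; lia|apply le_INR; lia]. }
  assert (Cau : forall N m n, (N <= m)%nat -> (N <= n)%nat ->
    nsq (hsub (s m) (s n)) <= 36 * / INR (S (S N))).
  { intros N m n Hm Hn. specialize (Pinv N).
    destruct (Hs m) as (Um & _ & Rm & Im). destruct (Hs n) as (Un & _ & Rn & In).
    destruct (phase_alignment (s m) (s n)) as (z & Hz & Hre & Him).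
    replace (36 * / INR (S (S N))) with (18 * (2 * / INR (S (S N)))) by ring.
    apply (overlap_phase_dist (e k0) (s m) (s n) _ z); try easy.
    - eapply Rlt_le_trans; [apply (Ht N)|now apply Ov].
    - enough (B : nsq (hsub (s m) (hscal z (s n))) * (2 * r - 1) <= 4 * (r - t N)).
      { unfold t in B. nra. }
      apply (overlap_midpoint e); try easy; [..|now apply Ov|].
      + rewrite nsq_scal, Hz, Un. ring.
      + apply Ht.
      + apply overlap_ge_phase; [easy|now apply Ov]. }
  destruct (hcomplete H s) as [eta Heta].
  { intros eps Heps. destruct (inv_nat_small (eps * eps / 36)) as [N HN]; [nra|].
    exists N. intros m n Hm Hn.
    change (hnorm (hsub (s m) (s n)) < eps).
    assert (B : nsq (hsub (s m) (s n)) < eps * eps).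
    { eapply Rle_lt_trans; [now apply (Cau N)|].
      enough (/ INR (S (S N)) <= / INR (S N)) by lra.
      apply Rinv_le_contravar; [apply lt_0_INR; lia|apply le_INR; lia]. }
    rewrite <- hnorm_sqr in B.
    pose proof (hnorm_ge0 (hsub (s m) (s n))). nra. }
  change (hcv s eta) in Heta.
  exists eta, r. split; [|split; [easy|split; [|easy]]].
  - apply (hcv_nsq s); [easy|]. intros n. apply Hs.
  - intros k.
    assert (Cv : Un_cv (fun n => Cnsq (inner (e k) (s n))) (Cnsq (inner (e k) eta))).
    { destruct (hcv_inner (e k) s eta Heta) as [C1 C2].
      apply (CV_plus (fun n => Cre (inner (e k) (s n)) * Cre (inner (e k) (s n))));
        now apply CV_mult. }
    assert (B : forall N, t N <= Cnsq (inner (e k) eta)).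
    { intros N. apply (Un_cv_lower_bound _ _ _ N Cv). intros n Hn. now apply Ov. }
    destruct (Rle_or_lt r (Cnsq (inner (e k) eta))) as [|Hlt]; [easy|].
    destruct (inv_nat_small (r - Cnsq (inner (e k) eta))) as [N HN]; [lra|].
    specialize (B N). unfold t in B.
    assert (/ INR (S (S N)) <= / INR (S N)).
    { apply Rinv_le_contravar; [apply lt_0_INR; lia|apply le_INR; lia]. }
    assert (r <= 1).
    { apply Hlub. intros x (v & Hv & Ho). eapply Rle_trans; [apply (Ho k0)|].
      eapply Rle_trans; [apply cauchy_schwarz|]. rewrite He, Hv. lra. }
    specialize (Pinv N). nra.
Qed.

(* The circumcentre of a small set in projective space is unique, hence fixed by
   every symmetry of the set. *)
Lemma fixed_line {K : Type} (e : K -> H) (k0 : K) (rho : R) (xi : H) :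
  (forall k, nsq (e k) = 1) -> nsq xi = 1 -> 1/2 < rho -> overlap_ge e xi rho ->
  exists eta, nsq eta = 1 /\ overlap_ge e eta rho /\
    forall U : H -> H, is_unitary U -> (forall k, exists k', e k = U (e k')) ->
      exists z, Cnsq z = 1 /\ U eta = hscal z eta.
Proof.
  intros He Hxi Hrho Oxi.
  destruct (overlap_maximizer e k0 rho xi) as (eta & r & Heta & Hr & Ho & Hmax); try easy.
  exists eta. split; [easy|]. split; [intros k; specialize (Ho k); lra|].
  intros U (_ & _ & Hin & _) HU.
  assert (Oe : overlap_ge e (U eta) r).
  { intros k. destruct (HU k) as [k' ->]. rewrite Hin. apply Ho. }
  assert (nU : nsq (U eta) = 1) by (unfold nsq; now rewrite Hin).
  destruct (phase_alignment eta (U eta)) as (z & Hz & Hre & Him).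
  (* Both vectors attain the maximum [r], so the room left for a better midpoint, hence their
     distance, is zero. *)
  assert (B : nsq (hsub eta (hscal z (U eta))) * (2 * r - 1) <= 4 * (r - r)).
  { apply (overlap_midpoint e); try easy.
    - rewrite nsq_scal, Hz, nU. ring.
    - lra.
    - now apply overlap_ge_phase. }
  assert (E : eta = hscal z (U eta)).
  { apply nsq_sub_eq. nra. }
  exists (Cconj z). split; [now rewrite Cnsq_conj|].
  rewrite E at 2. rewrite hscal_assoc.
  replace (Cmul (Cconj z) z) with Defs.C1; [now rewrite hscal_one|].
  unfold Cnsq in Hz. apply Cx_eq; simpl; [rewrite <- Hz|]; ring.
Qed.

End Hilbert.

(** * The Hilbert space of square-summable functions on an arbitrary type *)

Section Sums.
Context {X : Type}.
Implicit Types (f g : X -> R) (l : list X).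

Definition lsum f l : R := fold_right (fun x a => f x + a) 0 l.

Lemma lsum_add f g l : lsum (fun x => f x + g x) l = lsum f l + lsum g l.
Proof. induction l as [|x l IH]; simpl; [ring|]. rewrite IH. ring. Qed.

Lemma lsum_scal c f l : lsum (fun x => c * f x) l = c * lsum f l.
Proof. induction l as [|x l IH]; simpl; [ring|]. rewrite IH. ring. Qed.

Lemma lsum_le f g l : (forall x, f x <= g x) -> lsum f l <= lsum g l.
Proof. intros Hf. induction l as [|x l IH]; simpl; [lra|]. specialize (Hf x). lra. Qed.

Lemma lsum_ge0 f l : (forall x, 0 <= f x) -> 0 <= lsum f l.
Proof. intros Hf. induction l as [|x l IH]; simpl; [lra|]. specialize (Hf x). lra. Qed.

Lemma lsum_app f l1 l2 : lsum f (l1 ++ l2) = lsum f l1 + lsum f l2.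
Proof. induction l1 as [|x l IH]; simpl; [ring|]. rewrite IH. ring. Qed.

Lemma lsum_incl f l1 l2 :
  (forall x, 0 <= f x) -> NoDup l1 -> incl l1 l2 -> lsum f l1 <= lsum f l2.
Proof.
  intros Hf N1. revert l2. induction N1 as [|x l1 Hx N1 IH]; intros l2 Hi.
  - now apply lsum_ge0.
  - destruct (in_split x l2) as (a & b & ->); [apply Hi; now left|].
    assert (Hi' : incl l1 (a ++ b)).
    { intros y Hy. specialize (Hi y (or_intror Hy)). apply in_app_iff in Hi.
      apply in_app_iff. destruct Hi as [|[->|]]; tauto. }
    specialize (IH _ Hi'). rewrite lsum_app in *. simpl. lra.
Qed.

Lemma NoDup_union l1 l2 : exists l, NoDup l /\ incl l1 l /\ incl l2 l.
Proof.
  exists (nodup (fun x y => excluded_middle_informative (x = y)) (l1 ++ l2)).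
  split; [apply NoDup_nodup|].
  split; intros x Hx; apply nodup_In, in_app_iff; tauto.
Qed.

(** Unconditional convergence along the net of finite subsets, encoded as duplicate-free lists: the
    coset space may be uncountable and carries no enumeration. *)
Definition has_sum f (s : R) : Prop :=
  forall eps, 0 < eps -> exists l0, forall l, NoDup l -> incl l0 l ->
    Rabs (lsum f l - s) <= eps.

Definition bounded_sums f : Prop := exists M, forall l, NoDup l -> lsum f l <= M.

Lemma has_sum_unique f s s' : has_sum f s -> has_sum f s' -> s = s'.
Proof.
  intros Hs Hs'. apply NNPP. intros Hn.
  assert (P : 0 < Rabs (s - s')) by (apply Rabs_pos_lt; lra).
  destruct (Hs (Rabs (s - s') / 3)) as [l1 H1]; [lra|].
  destruct (Hs' (Rabs (s - s') / 3)) as [l2 H2]; [lra|].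
  destruct (NoDup_union l1 l2) as (l & N & I1 & I2).
  specialize (H1 l N I1). specialize (H2 l N I2).
  unfold Rabs in *. repeat destruct Rcase_abs; lra.
Qed.

Lemma has_sum_add f g s s' :
  has_sum f s -> has_sum g s' -> has_sum (fun x => f x + g x) (s + s').
Proof.
  intros Hs Hs' eps He.
  destruct (Hs (eps / 2)) as [l1 H1]; [lra|].
  destruct (Hs' (eps / 2)) as [l2 H2]; [lra|].
  exists (l1 ++ l2). intros l N I. apply incl_app_inv in I as [I1 I2].
  specialize (H1 l N I1). specialize (H2 l N I2).
  rewrite lsum_add. unfold Rabs in *. repeat destruct Rcase_abs; lra.
Qed.

Lemma has_sum_scal c f s : has_sum f s -> has_sum (fun x => c * f x) (c * s).
Proof.
  intros Hs eps He. pose proof (Rabs_pos c).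
  destruct (Hs (eps / (Rabs c + 1))) as [l0 H0]; [apply Rdiv_lt_0_compat; lra|].
  exists l0. intros l N I. specialize (H0 l N I).
  rewrite lsum_scal, <- Rmult_minus_distr_l, Rabs_mult.
  apply (Rmult_le_compat_l (Rabs c + 1)) in H0; [|lra].
  replace ((Rabs c + 1) * (eps / (Rabs c + 1))) with eps in H0 by (field; lra).
  pose proof (Rabs_pos (lsum f l - s)). lra.
Qed.

Lemma has_sum_bounded f : (forall x, 0 <= f x) -> bounded_sums f -> exists s, has_sum f s.
Proof.
  intros Hf [M HM].
  destruct (completeness (fun t => exists l, NoDup l /\ t = lsum f l)) as [s [Hub Hlub]].
  { exists M. intros t (l & N & ->). auto. }
  { exists 0, nil. split; [constructor|easy]. }
  exists s. intros eps He.
  assert (exists l0, NoDup l0 /\ s - eps < lsum f l0) as (l0 & N0 & H0).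
  { apply NNPP. intros Hn. enough (s <= s - eps) by lra. apply Hlub.
    intros t (l & N & ->). destruct (Rle_or_lt (lsum f l) (s - eps)); [easy|].
    exfalso. eauto. }
  exists l0. intros l N I. pose proof (lsum_incl f l0 l Hf N0 I).
  assert (lsum f l <= s) by (apply Hub; eauto).
  apply Rabs_le. lra.
Qed.

(** [f] is the difference of the nonnegative summable functions [f + g] and [g]. *)
Lemma has_sum_dominated f g :
  (forall x, Rabs (f x) <= g x) -> bounded_sums g -> exists s, has_sum f s.
Proof.
  intros Hfg [M HM].
  assert (Hg : forall x, - g x <= f x <= g x).
  { intros x. specialize (Hfg x). unfold Rabs in Hfg. destruct Rcase_abs; lra. }
  destruct (has_sum_bounded g) as [s Hs]; [|now exists M|].
  { intros x. specialize (Hg x). lra. }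
  destruct (has_sum_bounded (fun x => f x + g x)) as [s' Hs'].
  { intros x. specialize (Hg x). lra. }
  { exists (2 * M). intros l N. specialize (HM l N).
    assert (lsum (fun x => f x + g x) l <= lsum (fun x => 2 * g x) l).
    { apply lsum_le. intros x. specialize (Hg x). lra. }
    rewrite lsum_scal in *. lra. }
  exists (s' + -1 * s).
  replace f with (fun x => (f x + g x) + -1 * g x)
    by (apply functional_extensionality; intros; ring).
  apply has_sum_add; [easy|]. now apply has_sum_scal.
Qed.

Lemma lsum_le_has_sum f s l : (forall x, 0 <= f x) -> has_sum f s -> NoDup l -> lsum f l <= s.
Proof.
  intros Hf Hs N. apply Rnot_lt_le. intros Hlt.
  destruct (Hs ((lsum f l - s) / 2)) as [l0 H0]; [lra|].
  destruct (NoDup_union l l0) as (l' & N' & I & I0).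
  specialize (H0 l' N' I0). pose proof (lsum_incl f l l' Hf N I).
  unfold Rabs in H0. destruct Rcase_abs; lra.
Qed.

Lemma has_sum_le_bound f s M : has_sum f s -> (forall l, NoDup l -> lsum f l <= M) -> s <= M.
Proof.
  intros Hs HM. apply Rnot_lt_le. intros Hlt.
  destruct (Hs ((s - M) / 2)) as [l0 H0]; [lra|].
  destruct (NoDup_union l0 nil) as (l & N & I & _).
  specialize (H0 l N I). specialize (HM l N).
  unfold Rabs in H0. destruct Rcase_abs; lra.
Qed.

Lemma lsum_map f (s : X -> X) l : lsum f (map s l) = lsum (fun x => f (s x)) l.
Proof. induction l as [|x l IH]; simpl; [easy|]. now rewrite IH. Qed.

Lemma NoDup_map_cancel (s t : X -> X) l :
  (forall x, t (s x) = x) -> NoDup l -> NoDup (map s l).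
Proof.
  intros Hs. apply NoDup_map_NoDup_ForallPairs.
  intros x y _ _ E. now rewrite <- (Hs x), E.
Qed.

Lemma has_sum_reindex f v (s t : X -> X) :
  (forall x, t (s x) = x) -> (forall x, s (t x) = x) ->
  has_sum f v -> has_sum (fun x => f (s x)) v.
Proof.
  intros Hs Ht Hv eps He. destruct (Hv eps He) as [l0 H0].
  exists (map t l0). intros l N I. rewrite <- lsum_map. apply H0.
  - now apply (NoDup_map_cancel s t).
  - intros x Hx. rewrite <- (Ht x). apply in_map, I, in_map, Hx.
Qed.

Lemma has_sum_single f x0 : (forall x, x <> x0 -> f x = 0) -> has_sum f (f x0).
Proof.
  intros Hf eps He. exists (x0 :: nil). intros l N I.
  assert (Z : forall l, ~ In x0 l -> lsum f l = 0).
  { intros l'. induction l' as [|y l' IH]; simpl; [easy|]. intros Hn.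
    rewrite IH, Hf by (intuition congruence). ring. }
  destruct (in_split x0 l) as (a & b & ->); [apply I; now left|].
  apply NoDup_remove_2 in N. rewrite in_app_iff in N.
  rewrite lsum_app. simpl. rewrite !Z by tauto.
  replace (0 + (f x0 + 0) - f x0) with 0 by ring. rewrite Rabs_R0. lra.
Qed.

Definition tsum f : R := epsilon (inhabits 0) (has_sum f).

Lemma tsum_eq f s : has_sum f s -> tsum f = s.
Proof.
  intros Hs. apply (has_sum_unique f); [|easy].
  apply (epsilon_spec (inhabits 0) (has_sum f)). eauto.
Qed.

Lemma tsum_spec f : (exists s, has_sum f s) -> has_sum f (tsum f).
Proof. intros [s Hs]. now rewrite (tsum_eq f s). Qed.

End Sums.

(** * The space of square-summable functions as a [HilbertSpace] *)

Section L2.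
Context (X : Type).
Implicit Types u v w : X -> Cx.

Definition square_summable u : Prop := bounded_sums (fun x => Cnsq (u x)).

Definition l2 : Type := { u : X -> Cx | square_summable u }.

Lemma l2_eq (u v : l2) : (forall x, proj1_sig u x = proj1_sig v x) -> u = v.
Proof.
  destruct u as [u Hu], v as [v Hv]. simpl. intros E.
  apply functional_extensionality in E. subst v. f_equal. apply proof_irrelevance.
Qed.

Lemma square_summable_le u v c :
  0 <= c -> (forall x, Cnsq (u x) <= c * Cnsq (v x)) -> square_summable v -> square_summable u.
Proof.
  intros Hc Huv [M HM]. exists (c * M). intros l N. specialize (HM l N).
  eapply Rle_trans; [apply lsum_le; exact Huv|]. rewrite lsum_scal. nra.
Qed.

Lemma square_summable_add u v :
  square_summable u -> square_summable v -> square_summable (fun x => Cadd (u x) (v x)).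
Proof.
  intros [M HM] [M' HM']. exists (2 * M + 2 * M'). intros l N.
  specialize (HM l N). specialize (HM' l N).
  eapply Rle_trans;
    [apply (lsum_le _ (fun x => 2 * Cnsq (u x) + 2 * Cnsq (v x)))|].
  - intros x. unfold Cnsq; simpl.
    pose proof (Rle_0_sqr (Cre (u x) - Cre (v x))) as Q1.
    pose proof (Rle_0_sqr (Cim (u x) - Cim (v x))) as Q2. unfold Rsqr in *. lra.
  - rewrite lsum_add, !lsum_scal. lra.
Qed.

Lemma square_summable_scal a u : square_summable u -> square_summable (fun x => Cmul a (u x)).
Proof.
  apply (square_summable_le _ _ (Cnsq a)); [apply Cnsq_ge0|].
  intros x. rewrite Cnsq_mul. lra.
Qed.

Lemma square_summable_zero : square_summable (fun _ : X => C0).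
Proof.
  exists 0. intros l _. induction l as [|x l IH]; simpl; unfold Cnsq in *; simpl in *; lra.
Qed.

Definition l2_zero : l2 := exist _ _ square_summable_zero.
Definition l2_add (u v : l2) : l2 :=
  exist _ _ (square_summable_add _ _ (proj2_sig u) (proj2_sig v)).
Definition l2_scal (a : Cx) (u : l2) : l2 :=
  exist _ _ (square_summable_scal a _ (proj2_sig u)).
Definition l2_opp (u : l2) : l2 := l2_scal (mkC (-1) 0) u.

Definition l2_inner (u v : l2) : Cx :=
  mkC (tsum (fun x => Cre (Cmul (proj1_sig u x) (Cconj (proj1_sig v x)))))
      (tsum (fun x => Cim (Cmul (proj1_sig u x) (Cconj (proj1_sig v x))))).

Definition has_csum (f : X -> Cx) (s : Cx) : Prop :=
  has_sum (fun x => Cre (f x)) (Cre s) /\ has_sum (fun x => Cim (f x)) (Cim s).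

Lemma has_csum_unique f s s' : has_csum f s -> has_csum f s' -> s = s'.
Proof. intros [] []. apply Cx_eq; eapply has_sum_unique; eauto. Qed.

Lemma has_csum_add f g s s' :
  has_csum f s -> has_csum g s' -> has_csum (fun x => Cadd (f x) (g x)) (Cadd s s').
Proof. intros [] []. split; simpl; now apply has_sum_add. Qed.

Lemma has_csum_scal a f s : has_csum f s -> has_csum (fun x => Cmul a (f x)) (Cmul a s).
Proof.
  intros [H1 H2]. split; simpl.
  - replace (fun x => Cre a * Cre (f x) - Cim a * Cim (f x))
      with (fun x => Cre a * Cre (f x) + (- Cim a) * Cim (f x))
      by (apply functional_extensionality; intros; ring).
    replace (Cre a * Cre s - Cim a * Cim s) with (Cre a * Cre s + (- Cim a) * Cim s) by ring.
    apply has_sum_add; now apply has_sum_scal.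
  - apply has_sum_add; now apply has_sum_scal.
Qed.

Lemma has_csum_conj f s : has_csum f s -> has_csum (fun x => Cconj (f x)) (Cconj s).
Proof.
  intros [H1 H2]. split; simpl; [easy|].
  replace (fun x => - Cim (f x)) with (fun x => -1 * Cim (f x))
    by (apply functional_extensionality; intros; ring).
  replace (- Cim s) with (-1 * Cim s) by ring. now apply has_sum_scal.
Qed.

Lemma l2_inner_sum (u v : l2) :
  has_csum (fun x => Cmul (proj1_sig u x) (Cconj (proj1_sig v x))) (l2_inner u v).
Proof.
  (* Both parts of a product are dominated by the sum of the two squared moduli. *)
  assert (B : bounded_sums (fun x => Cnsq (proj1_sig u x) + Cnsq (proj1_sig v x))).
  { destruct (proj2_sig u) as [M HM], (proj2_sig v) as [M' HM'].
    exists (M + M'). intros l N. rewrite lsum_add. specialize (HM l N). specialize (HM' l N). lra. }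
  split; simpl; apply tsum_spec; refine (has_sum_dominated _ _ _ B); intros x;
    destruct (proj1_sig u x) as [a b], (proj1_sig v x) as [c d]; unfold Cnsq; simpl;
    apply Rabs_le;
    pose proof (Rle_0_sqr (a - c)); pose proof (Rle_0_sqr (a + c));
    pose proof (Rle_0_sqr (b - d)); pose proof (Rle_0_sqr (b + d));
    pose proof (Rle_0_sqr (a - d)); pose proof (Rle_0_sqr (a + d));
    pose proof (Rle_0_sqr (b - c)); pose proof (Rle_0_sqr (b + c));
    unfold Rsqr in *; split; lra.
Qed.

Lemma l2_nsq_sum (u : l2) :
  has_sum (fun x => Cnsq (proj1_sig u x)) (Cre (l2_inner u u)).
Proof.
  destruct (l2_inner_sum u u) as [Hs _].
  replace (fun x => Cnsq (proj1_sig u x))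
    with (fun x => Cre (Cmul (proj1_sig u x) (Cconj (proj1_sig u x)))); [easy|].
  apply functional_extensionality. intros x. unfold Cnsq. simpl. ring.
Qed.

Lemma l2_lsum_le (u : l2) l :
  NoDup l -> lsum (fun x => Cnsq (proj1_sig u x)) l <= Cre (l2_inner u u).
Proof.
  apply lsum_le_has_sum; [intros; apply Cnsq_ge0|apply l2_nsq_sum].
Qed.

Lemma l2_coord_le (u : l2) x : Cnsq (proj1_sig u x) <= Cre (l2_inner u u).
Proof.
  pose proof (l2_lsum_le u (x :: nil)) as Hl. simpl in Hl.
  rewrite Rplus_0_r in Hl. apply Hl. repeat constructor. easy.
Qed.

Lemma l2_inner_pos (u : l2) : 0 <= Cre (l2_inner u u).
Proof. apply (l2_lsum_le u nil). constructor. Qed.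

Lemma lsum_cv (f : nat -> X -> R) (g : X -> R) l :
  (forall x, Un_cv (fun n => f n x) (g x)) -> Un_cv (fun n => lsum (f n) l) (lsum g l).
Proof.
  intros Hf. induction l as [|x l IH]; simpl.
  - apply Un_cv_const.
  - now apply CV_plus.
Qed.

(** The limit is taken pointwise. The Cauchy bound holds on every finite set, uniformly in the set,
    so it survives the passage to the limit there and then extends to the full sum. *)
Lemma l2_complete (s : nat -> l2) :
  (forall eps, 0 < eps -> exists N, forall m n, (N <= m)%nat -> (N <= n)%nat ->
    sqrt (Cre (l2_inner (l2_add (s m) (l2_opp (s n))) (l2_add (s m) (l2_opp (s n))))) < eps) ->
  exists l, forall eps, 0 < eps -> exists N, forall n, (N <= n)%nat ->
    sqrt (Cre (l2_inner (l2_add (s n) (l2_opp l)) (l2_add (s n) (l2_opp l)))) < eps.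
Proof.
  intros Hc.
  set (d := fun m n => l2_add (s m) (l2_opp (s n))).
  assert (Hd : forall eps, 0 < eps -> exists N, forall m n, (N <= m)%nat -> (N <= n)%nat ->
    Cre (l2_inner (d m n) (d m n)) <= eps * eps).
  { intros eps He. destruct (Hc eps He) as [N HN]. exists N. intros m n Hm Hn.
    specialize (HN m n Hm Hn). fold (d m n) in HN.
    pose proof (sqrt_pos (Cre (l2_inner (d m n) (d m n)))).
    rewrite <- (sqrt_sqrt (Cre (l2_inner (d m n) (d m n)))) by apply l2_inner_pos. nra. }
  assert (Hx : forall x, exists a : Cx,
    Un_cv (fun n => Cre (proj1_sig (s n) x)) (Cre a) /\
    Un_cv (fun n => Cim (proj1_sig (s n) x)) (Cim a)).
  { intros x.
    assert (Hre : Cauchy_crit (fun n => Cre (proj1_sig (s n) x)) /\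
                  Cauchy_crit (fun n => Cim (proj1_sig (s n) x))).
    { split; intros eps He; (destruct (Hd (eps / 2)) as [N HN]; [lra|]);
        exists N; intros m n Hm Hn; specialize (HN m n Hm Hn);
        pose proof (l2_coord_le (d m n) x) as Hx; simpl in Hx; unfold Cnsq in Hx; simpl in Hx;
        unfold Rdist; (apply Rle_lt_trans with (eps / 2); [|lra]);
        (apply Rabs_sqr_le; [lra|]); (eapply Rle_trans; [|exact HN]);
        (eapply Rle_trans; [|exact Hx]);
        [pose proof (Rle_0_sqr (Cim (proj1_sig (s m) x) - Cim (proj1_sig (s n) x))) as Q
        |pose proof (Rle_0_sqr (Cre (proj1_sig (s m) x) - Cre (proj1_sig (s n) x))) as Q];
        unfold Rsqr in Q; lra. }
    destruct Hre as [Hre Him]. apply R_complete in Hre as [a Ha]. apply R_complete in Him as [b Hb].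
    now exists (mkC a b). }
  apply choice in Hx as [l Hl].
  assert (Hlim : forall eps, 0 < eps -> exists N, forall n, (N <= n)%nat ->
    forall L, NoDup L ->
      lsum (fun x => Cnsq (Cadd (proj1_sig (s n) x) (Cmul (mkC (-1) 0) (l x)))) L <= eps * eps).
  { intros eps He. destruct (Hd eps He) as [N HN]. exists N. intros n Hn L HL.
    (* Negated so that [Un_cv_lower_bound] yields an upper bound. *)
    assert (Cv : Un_cv (fun m => - lsum (fun x => Cnsq (proj1_sig (d n m) x)) L)
      (- lsum (fun x => Cnsq (Cadd (proj1_sig (s n) x) (Cmul (mkC (-1) 0) (l x)))) L)).
    { apply CV_opp. apply lsum_cv. intros x. destruct (Hl x) as [Hre Him].
      unfold Cnsq. simpl.
      repeat first [apply CV_plus|apply CV_minus|apply CV_mult|apply CV_opp|apply Un_cv_const|assumption]. }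
    apply Ropp_le_cancel. apply (Un_cv_lower_bound _ _ _ N Cv). intros m Hm.
    apply Ropp_le_contravar. eapply Rle_trans; [now apply l2_lsum_le|]. now apply HN. }
  assert (Hl2 : square_summable l).
  { destruct (Hlim 1) as [N HN]; [lra|]. specialize (HN N (le_n N)).
    assert (Hdiff : square_summable
      (fun x => Cadd (proj1_sig (s N) x) (Cmul (mkC (-1) 0) (l x)))) by (now exists (1 * 1)).
    (* The limit is [s N] minus the square-summable difference [s N - l]. *)
    pose proof (square_summable_add _ _ (proj2_sig (s N))
                  (square_summable_scal (mkC (-1) 0) _ Hdiff)) as Hs.
    replace l with (fun x => Cadd (proj1_sig (s N) x) (Cmul (mkC (-1) 0)
      (Cadd (proj1_sig (s N) x) (Cmul (mkC (-1) 0) (l x))))); [exact Hs|].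
    apply functional_extensionality. intros x. apply Cx_eq; simpl; ring. }
  exists (exist _ l Hl2). intros eps He.
  destruct (Hlim (eps / 2)) as [N HN]; [lra|]. exists N. intros n Hn. specialize (HN n Hn).
  apply Rle_lt_trans with (eps / 2); [|lra].
  rewrite <- (sqrt_square (eps / 2)) by lra. apply sqrt_le_1_alt.
  eapply has_sum_le_bound; [apply l2_nsq_sum|]. exact HN.
Qed.

Definition l2_space : HilbertSpace.
Proof.
  refine {| hcar := l2; hzero := l2_zero; hadd := l2_add; hopp := l2_opp;
            hscal := l2_scal; inner := l2_inner; hcomplete := l2_complete |};
    try (intros; apply l2_eq; intros; apply Cx_eq; simpl; ring).
  - intros u v w.
    apply (has_csum_unique (fun x => Cadd (Cmul (proj1_sig u x) (Cconj (proj1_sig w x)))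
                                          (Cmul (proj1_sig v x) (Cconj (proj1_sig w x))))).
    + replace (fun x => Cadd (Cmul (proj1_sig u x) (Cconj (proj1_sig w x)))
                             (Cmul (proj1_sig v x) (Cconj (proj1_sig w x))))
        with (fun x => Cmul (proj1_sig (l2_add u v) x) (Cconj (proj1_sig w x)));
        [apply l2_inner_sum|].
      apply functional_extensionality. intros x. apply Cx_eq; simpl; ring.
    + apply has_csum_add; apply l2_inner_sum.
  - intros a u w.
    apply (has_csum_unique (fun x => Cmul a (Cmul (proj1_sig u x) (Cconj (proj1_sig w x))))).
    + replace (fun x => Cmul a (Cmul (proj1_sig u x) (Cconj (proj1_sig w x))))
        with (fun x => Cmul (proj1_sig (l2_scal a u) x) (Cconj (proj1_sig w x)));
        [apply l2_inner_sum|].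
      apply functional_extensionality. intros x. apply Cx_eq; simpl; ring.
    + apply has_csum_scal, l2_inner_sum.
  - intros u v.
    apply (has_csum_unique (fun x => Cmul (proj1_sig v x) (Cconj (proj1_sig u x))));
      [apply l2_inner_sum|].
    replace (fun x => Cmul (proj1_sig v x) (Cconj (proj1_sig u x)))
      with (fun x => Cconj (Cmul (proj1_sig u x) (Cconj (proj1_sig v x))));
      [apply has_csum_conj, l2_inner_sum|].
    apply functional_extensionality. intros x. apply Cx_eq; simpl; ring.
  - exact l2_inner_pos.
  - intros u Hu. apply l2_eq. intros x. pose proof (l2_coord_le u x) as Hx.
    rewrite Hu in Hx. unfold Cnsq in Hx. apply Cx_eq; simpl; nra.
Defined.

End L2.

(** * Monomial operators and the induced quasi-representation *)

Definition cis (t : R) : Cx := mkC (cos t) (sin t).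

Lemma Cnsq_cis t : Cnsq (cis t) = 1.
Proof. unfold Cnsq, cis; simpl. pose proof (sin2_cos2 t) as E. unfold Rsqr in E. lra. Qed.

Lemma cis_add s t : cis (s + t) = Cmul (cis s) (cis t).
Proof. apply Cx_eq; simpl; [rewrite cos_plus|rewrite sin_plus]; ring. Qed.

Lemma cis_0 : cis 0 = Defs.C1.
Proof. apply Cx_eq; simpl; [apply cos_0|apply sin_0]. Qed.

Lemma cis_mul_opp t : Cmul (cis t) (cis (- t)) = Defs.C1.
Proof. now rewrite <- cis_add, Rplus_opp_r, cis_0. Qed.

Lemma sin_sqr_le y : sin y * sin y <= y * y.
Proof.
  assert (P : forall x, 0 <= x -> sin x * sin x <= x * x).
  { intros x Hx. pose proof (SIN_bound x) as [B1 B2].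
    destruct (Rle_lt_or_eq_dec 0 x Hx) as [Px|<-]; [|rewrite sin_0; lra].
    pose proof (sin_lt_x x Px).
    destruct (Rle_or_lt x 1).
    - assert (0 <= sin x) by (apply sin_ge_0; pose proof PI_RGT_0; pose proof PI2_1; lra). nra.
    - nra. }
  destruct (Rle_or_lt 0 y); [auto|].
  specialize (P (- y)). rewrite sin_neg in P. lra.
Qed.

(** A chord is at most its arc: the left side is 4 sin^2((s - t)/2). *)
Lemma Cnsq_cis_sub s t :
  Cnsq (Cadd (cis s) (Cmul (mkC (-1) 0) (cis t))) <= (s - t) * (s - t).
Proof.
  assert (E : Cnsq (Cadd (cis s) (Cmul (mkC (-1) 0) (cis t))) = 2 - 2 * cos (s - t)).
  { pose proof (Cnsq_cis s) as E1. pose proof (Cnsq_cis t) as E2.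
    rewrite cos_minus. unfold Cnsq, cis in *. simpl in *. lra. }
  rewrite E. replace (s - t) with (2 * ((s - t) / 2)) at 1 by lra.
  rewrite cos_2a_sin. pose proof (sin_sqr_le ((s - t) / 2)). lra.
Qed.

Section Monomial.
Context {X : Type}.

(** The permutation acts on the argument, so translation by a group element g is obtained from the
    action of g^-1. *)
Definition monomial (A : l2_space X -> l2_space X) (th : X -> R) (s : X -> X) : Prop :=
  forall u x, proj1_sig (A u) x = Cmul (cis (th x)) (proj1_sig u (s x)).

Lemma monomial_exists (th : X -> R) (s t : X -> X) :
  (forall x, t (s x) = x) -> exists A, monomial A th s.
Proof.
  intros Hs.
  assert (Hsum : forall u : l2 X,
    square_summable X (fun x => Cmul (cis (th x)) (proj1_sig u (s x)))).
  { intros [u [M HM]]. exists M. intros l N. simpl.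
    replace (fun x => Cnsq (Cmul (cis (th x)) (u (s x)))) with (fun x => Cnsq (u (s x))).
    - rewrite <- (lsum_map (fun x => Cnsq (u x))). apply HM. now apply (NoDup_map_cancel s t).
    - apply functional_extensionality. intros x. rewrite Cnsq_mul, Cnsq_cis. ring. }
  now exists (fun u => exist _ _ (Hsum u)).
Qed.

Lemma monomial_unitary A (th : X -> R) (s t : X -> X) :
  (forall x, t (s x) = x) -> (forall x, s (t x) = x) -> monomial A th s -> is_unitary A.
Proof.
  intros Hs Ht HA. repeat split.
  - intros u v. apply l2_eq. intros x. simpl. rewrite !HA. cx.
  - intros a u. apply l2_eq. intros x. simpl. rewrite !HA. cx.
  - intros u v. apply (has_csum_unique X
      (fun x => Cmul (proj1_sig (A u) x) (Cconj (proj1_sig (A v) x))));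
      [apply l2_inner_sum|].
    replace (fun x => Cmul (proj1_sig (A u) x) (Cconj (proj1_sig (A v) x)))
      with (fun x => Cmul (proj1_sig u (s x)) (Cconj (proj1_sig v (s x)))).
    + destruct (l2_inner_sum X u v) as [H1 H2]. split.
      * exact (has_sum_reindex _ _ s t Hs Ht H1).
      * exact (has_sum_reindex _ _ s t Hs Ht H2).
    + apply functional_extensionality. intros x. rewrite !HA.
      transitivity (Cmul (Cmul (cis (th x)) (Cconj (cis (th x))))
                         (Cmul (proj1_sig u (s x)) (Cconj (proj1_sig v (s x)))));
        [|cx].
      replace (Cmul (cis (th x)) (Cconj (cis (th x)))) with Defs.C1; [cx|].
      pose proof (Cnsq_cis (th x)) as E. unfold Cnsq in E.
      apply Cx_eq; simpl in *; [rewrite <- E|]; ring.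
  (* The preimage of [v] comes from the inverse monomial operator: permutation [t], phase opposite
     and moved along [t]. *)
  - intros v. destruct (monomial_exists (fun x => - th (t x)) t s Ht) as [B HB].
    exists (B v). apply l2_eq. intros x. rewrite HA, HB, Hs.
    transitivity (Cmul (Cmul (cis (th x)) (cis (- th x))) (proj1_sig v x)); [cx|].
    rewrite cis_mul_opp. cx.
Qed.

Lemma monomial_opdist A B (th th' : X -> R) (s t : X -> X) (delta : R) :
  (forall x, t (s x) = x) -> (forall x, s (t x) = x) -> 0 <= delta ->
  monomial A th s -> monomial B th' s ->
  (forall x, Rabs (th x - th' x) <= delta) -> opdist_le A B delta.
Proof.
  intros Hs Ht Hd HA HB Hth. split; [easy|]. intros u.
  assert (Key : nsq (hsub (A u) (B u)) <= delta * delta * nsq u).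
  { eapply has_sum_le_bound; [apply l2_nsq_sum|]. intros l N.
    apply Rle_trans with (lsum (fun x => delta * delta * Cnsq (proj1_sig u (s x))) l).
    - apply lsum_le. intros x.
      change (Cnsq (Cadd (proj1_sig (A u) x) (Cmul (mkC (-1) 0) (proj1_sig (B u) x)))
              <= delta * delta * Cnsq (proj1_sig u (s x))).
      rewrite HA, HB.
      replace (Cadd (Cmul (cis (th x)) (proj1_sig u (s x)))
                    (Cmul (mkC (-1) 0) (Cmul (cis (th' x)) (proj1_sig u (s x)))))
        with (Cmul (Cadd (cis (th x)) (Cmul (mkC (-1) 0) (cis (th' x)))) (proj1_sig u (s x)))
        by cx.
      rewrite Cnsq_mul. apply Rmult_le_compat_r; [apply Cnsq_ge0|].
      eapply Rle_trans; [apply Cnsq_cis_sub|]. specialize (Hth x).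
      unfold Rabs in Hth. destruct Rcase_abs; nra.
    - rewrite lsum_scal. apply Rmult_le_compat_l; [nra|].
      rewrite <- (lsum_map (fun x => Cnsq (proj1_sig u x))).
      apply (l2_lsum_le X u). now apply (NoDup_map_cancel s t). }
  rewrite <- !hnorm_sqr in Key.
  pose proof (hnorm_ge0 u) as P1. pose proof (hnorm_ge0 (hsub (A u) (B u))) as P2.
  set (h := hnorm (hsub (A u) (B u))) in *. set (h' := hnorm u) in *.
  assert (0 <= delta * h') by nra.
  apply Rnot_lt_le. intros Hlt. nra.
Qed.

Lemma delta_vector (o : X) :
  exists xi : l2_space X, nsq xi = 1 /\ proj1_sig xi o = Defs.C1 /\
    forall x, x <> o -> proj1_sig xi x = C0.
Proof.
  set (d := fun x : X => if excluded_middle_informative (x = o) then Defs.C1 else C0).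
  assert (Ho : d o = Defs.C1) by (unfold d; now destruct excluded_middle_informative).
  assert (Hn : forall x, x <> o -> d x = C0)
    by (intros x Hx; unfold d; now destruct excluded_middle_informative).
  assert (Hsum : has_sum (fun x => Cnsq (d x)) 1).
  { replace 1 with (Cnsq (d o)) by (rewrite Ho; unfold Cnsq; simpl; ring).
    apply (has_sum_single (fun x => Cnsq (d x))).
    intros x Hx. rewrite Hn by easy. unfold Cnsq; simpl; ring. }
  assert (Hd : square_summable X d).
  { exists 1. intros l N. apply lsum_le_has_sum; [intros; apply Cnsq_ge0|easy..]. }
  exists (exist _ d Hd). split; [|easy].
  exact (has_sum_unique _ _ _ (l2_nsq_sum X (exist _ d Hd)) Hsum).
Qed.

End Monomial.

(** Elements of one left coset define the same predicate, by extensionality, and [epsilon] chooses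
    the same witness for equal predicates. The coset [L] is treated apart to make its representative
    exactly [gone]. *)
Lemma coset_representatives {G : Group} (L : G -> Prop) :
  is_subgroup L ->
  exists rep : G -> G, (forall g, L (gmul (ginv g) (rep g))) /\
    (forall g h, L (gmul (ginv g) h) -> rep g = rep h) /\ rep gone = gone.
Proof.
  intros (L1 & LM & LV).
  set (P := fun g h => L (gmul (ginv g) h)).
  set (rep := fun g => if excluded_middle_informative (L g) then gone
                       else epsilon (inhabits gone) (P g)).
  exists rep. repeat split.
  - intros g. unfold rep. destruct excluded_middle_informative as [Lg|_].
    + rewrite gmul_one_r. auto.
    + apply (epsilon_spec (inhabits gone) (P g)). exists g. unfold P. now rewrite gmul_inv_l.
  - intros g h Lgh. unfold rep.
    assert (Lhg : L (gmul (ginv h) g)).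
    { apply LV in Lgh. now rewrite ginv_mul, ginv_inv in Lgh. }
    assert (EP : P g = P h).
    { apply functional_extensionality. intros k. apply propositional_extensionality.
      unfold P. split; intros Hk.
      - replace (gmul (ginv h) k) with (gmul (gmul (ginv h) g) (gmul (ginv g) k)); [auto|].
        now rewrite <- gmul_assoc, gmul_inv_cancel_r.
      - replace (gmul (ginv g) k) with (gmul (gmul (ginv g) h) (gmul (ginv h) k)); [auto|].
        now rewrite <- gmul_assoc, gmul_inv_cancel_r. }
    rewrite EP. do 2 destruct excluded_middle_informative; try easy; exfalso.
    + apply n. rewrite <- (gmul_inv_cancel_r g h). auto.
    + apply n. rewrite <- (gmul_inv_cancel_r h g). auto.
  - unfold rep. now destruct excluded_middle_informative.
Qed.

Lemma induced_quasirep {G : Group} (L : G -> Prop) (q : G -> R) (theta delta : R) :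
  is_subgroup L -> q gone = 0 ->
  (forall x y, L x -> L y -> Rabs (q (gmul x y) - q x - q y) <= 3) ->
  0 <= theta -> 3 * theta <= delta ->
  exists (H : HilbertSpace) (mu : G -> H -> H) (xi : H),
    is_unitary_map mu /\ unital mu /\ defect_le mu delta /\ nsq xi = 1 /\
    forall g, L g -> mu g xi = hscal (cis (theta * q g)) xi.
Proof.
  intros HL q1 Hq Hth Hdelta.
  destruct (coset_representatives L HL) as (rep & Hrep & Hrep' & rep1).
  destruct HL as (L1 & LM & LV).
  assert (rep_rep : forall g, rep (rep g) = rep g) by (intros g; symmetry; apply Hrep', Hrep).
  (* The fixed points of [rep] form a transversal, which stands in for the quotient G/L. *)
  set (X := { x : G | rep x = x }).
  assert (X_eq : forall x y : X, proj1_sig x = proj1_sig y -> x = y).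
  { intros [x Hx] [y Hy]. simpl. intros E. subst y. f_equal. apply proof_irrelevance. }
  set (act := fun g (x : X) => exist (fun x => rep x = x) (rep (gmul g (proj1_sig x)))
                (rep_rep (gmul g (proj1_sig x))) : X).
  assert (act_mul : forall g h x, act g (act h x) = act (gmul g h) x).
  { intros g h x. apply X_eq. simpl. symmetry. apply Hrep'.
    rewrite <- (gmul_assoc G g h), ginv_mul, <- gmul_assoc, gmul_inv_cancel_l. apply Hrep. }
  assert (act_1 : forall x, act gone x = x).
  { intros [x Hx]. apply X_eq. simpl. now rewrite gmul_one_l. }
  assert (act_V1 : forall g x, act g (act (ginv g) x) = x).
  { intros g x. now rewrite act_mul, gmul_inv_r. }
  assert (act_V2 : forall g x, act (ginv g) (act g x) = x).
  { intros g x. now rewrite act_mul, gmul_inv_l. }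
  (* The element of [L] by which g, applied to the representative of g^-1 x, misses the
     representative x. *)
  set (coc := fun g (x : X) => gmul (ginv (proj1_sig x)) (gmul g (proj1_sig (act (ginv g) x)))).
  assert (coc_L : forall g x, L (coc g x)).
  { intros g x. unfold coc. simpl. pose proof (Hrep (gmul (ginv g) (proj1_sig x))) as Hr.
    rewrite ginv_mul, ginv_inv, <- gmul_assoc in Hr. exact Hr. }
  assert (coc_mul : forall g h x, coc (gmul g h) x = gmul (coc g x) (coc h (act (ginv g) x))).
  { intros g h x. unfold coc. rewrite act_mul, <- ginv_mul, <- !gmul_assoc.
    now rewrite gmul_inv_cancel_r. }
  assert (Hmu : forall g, exists A : l2_space X -> l2_space X,
    monomial A (fun x => theta * q (coc g x)) (act (ginv g))).
  { intros g. apply (monomial_exists _ _ (act g)), act_V1. }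
  apply choice in Hmu as [mu Hmu].
  set (o := exist (fun x => rep x = x) gone rep1 : X).
  destruct (delta_vector o) as (xi & Hxi & Hxo & Hx0).
  exists (l2_space X), mu, xi. repeat apply conj.
  - intros g. apply (monomial_unitary _ _ (act (ginv g)) (act g) (act_V1 g) (act_V2 g) (Hmu g)).
  - intros u. apply l2_eq. intros x. rewrite Hmu. unfold coc.
    rewrite ginv_one, act_1, gmul_one_l, gmul_inv_l, q1, Rmult_0_r, cis_0. cx.
  - intros g h.
    apply (monomial_opdist _ _ (fun x => theta * q (coc (gmul g h) x))
      (fun x => theta * q (coc g x) + theta * q (coc h (act (ginv g) x)))
      (act (ginv (gmul g h))) (act (gmul g h))); auto.
    + lra.
    + intros u x. rewrite !Hmu, act_mul, <- ginv_mul, cis_add. cx.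
    + intros x. rewrite coc_mul, <- Rmult_plus_distr_l, <- Rmult_minus_distr_l, Rabs_mult.
      rewrite (Rabs_pos_eq theta) by easy.
      specialize (Hq (coc g x) (coc h (act (ginv g) x)) (coc_L _ _) (coc_L _ _)).
      unfold Rminus in Hq. rewrite Rplus_assoc, <- Ropp_plus_distr in Hq.
      unfold Rminus. nra.
  - exact Hxi.
  - intros g Lg. apply l2_eq. intros x. rewrite Hmu.
    change (Cmul (cis (theta * q (coc g x))) (proj1_sig xi (act (ginv g) x)) =
            Cmul (cis (theta * q g)) (proj1_sig xi x)).
    assert (fix_o : forall h, L h -> act h o = o).
    { intros h Lh. apply X_eq. simpl. rewrite gmul_one_r, <- rep1. symmetry. apply Hrep'.
      rewrite ginv_one, gmul_one_l. exact Lh. }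
    destruct (classic (x = o)) as [->|Hne].
    (* Since the trivial coset is represented by [gone], the cocycle at [o] is g itself and not a
       conjugate of it. *)
    + unfold coc. rewrite fix_o by auto. simpl. now rewrite ginv_one, gmul_one_l, gmul_one_r.
    + rewrite !Hx0; [cx|easy|]. intros E. apply Hne.
      now rewrite <- (act_V1 g x), E, fix_o.
Qed.

(** * Distance to homomorphisms *)

(** Multiplicativity makes [nu gone] idempotent, and a surjective idempotent is the identity. *)
Lemma hom_one {G : Group} {H : HilbertSpace} (nu : G -> H -> H) v :
  is_hom nu -> nu gone v = v.
Proof.
  intros [Hu Hm]. destruct (Hu gone) as (_ & _ & _ & Hs). destruct (Hs v) as [u <-].
  now rewrite <- Hm, gmul_one_l.
Qed.

Lemma hom_cancel {G : Group} {H : HilbertSpace} (nu : G -> H -> H) g v :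
  is_hom nu -> nu g (nu (ginv g) v) = v.
Proof. intros Hn. destruct Hn as [Hu Hm]. rewrite <- Hm, gmul_inv_r. now apply hom_one. Qed.

(** On the line of [eta] the group [L] acts by scalars, which commute; the eigenvalues of a and
    a^-1, and of b and b^-1, cancel in pairs. *)
Lemma hom_comm_fixes_eigenvector {G : Group} {H : HilbertSpace} (nu : G -> H -> H)
    (L : G -> Prop) (eta : H) a b n :
  is_hom nu -> is_subgroup L -> L a -> L b ->
  (forall g, L g -> exists z, nu g eta = hscal z eta) ->
  nu (gpow (gcomm a b) n) eta = eta.
Proof.
  intros Hn (_ & _ & LV) La Lb He.
  assert (Ec : nu (gcomm a b) eta = eta).
  { pose proof (hom_cancel nu a eta Hn) as Ea. pose proof (hom_cancel nu b eta Hn) as Eb.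
    destruct (He a La) as [z1 E1]. destruct (He b Lb) as [z2 E2].
    destruct (He (ginv a) (LV _ La)) as [z3 E3]. destruct (He (ginv b) (LV _ Lb)) as [z4 E4].
    destruct Hn as [Hu Hm].
    assert (Sc : forall g z, nu g (hscal z eta) = hscal z (nu g eta)) by (intros; apply Hu).
    rewrite E3, Sc, E1, hscal_assoc in Ea. rewrite E4, Sc, E2, hscal_assoc in Eb.
    unfold gcomm. rewrite !Hm, E4, Sc, E3, !hscal_assoc, Sc, E2, hscal_assoc, Sc, E1, hscal_assoc.
    rewrite <- Ea at 2. rewrite <- Eb at 2. rewrite hscal_assoc. f_equal. cx. }
  induction n as [|n IH]; simpl; [now apply hom_one|].
  destruct Hn as [Hu Hm]. now rewrite Hm, IH.
Qed.

Lemma far_from_hom {G : Group} {H : HilbertSpace} (mu : G -> H -> H) (L : G -> Prop)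
    (q : G -> R) (theta : R) (xi : H) a b n :
  is_subgroup L -> L a -> L b -> nsq xi = 1 ->
  (forall g, L g -> mu g xi = hscal (cis (theta * q g)) xi) ->
  theta * q (gpow (gcomm a b) n) = PI ->
  D_ge mu (1/2).
Proof.
  intros HL La Lb Hxi Hmu HPI c Hc nu Hnu Hdist.
  assert (Hc0 : 0 <= c) by apply (Hdist gone).
  assert (Hclose : forall g, L g -> nsq (hsub (mu g xi) (nu g xi)) <= c * c).
  { intros g _. destruct (Hdist g) as [_ Hd]. specialize (Hd xi).
    assert (E : hnorm xi = 1) by (unfold hnorm; fold (nsq xi); rewrite Hxi; apply sqrt_1).
    rewrite E in Hd. rewrite <- hnorm_sqr.
    pose proof (hnorm_ge0 (hsub (mu g xi) (nu g xi))). nra. }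
  assert (Hin : forall g u v, inner (nu g u) (nu g v) = inner u v) by apply Hnu.
  pose proof HL as (L1 & LM & LV).
  destruct (fixed_line (fun k : {g | L g} => nu (proj1_sig k) xi) (exist _ gone L1) (49/64) xi)
    as (eta & Heta & Ho & Hfix).
  - intros k. unfold nsq. now rewrite Hin.
  - exact Hxi.
  - lra.
  - intros [g Lg]. simpl. specialize (Hclose g Lg).
    rewrite nsq_sub, Hmu, nsq_scal, inner_scal_l, Cnsq_cis in Hclose by easy.
    assert (E : nsq (nu g xi) = 1) by (unfold nsq; now rewrite Hin).
    rewrite E, Hxi in Hclose. rewrite (inner_conj_sym H xi (nu g xi)), Cnsq_conj.
    set (w := inner xi (nu g xi)) in *.
    pose proof (Cnsq_cis (theta * q g)) as Hz. set (z := cis (theta * q g)) in *.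
    (* For unit vectors the squared distance is 2 - 2 Re(zw), and it is below 1/4. *)
    assert (Hre : 7/8 <= Cre (Cmul z w)) by nra.
    rewrite <- (Rmult_1_l (Cnsq w)), <- Hz, <- Cnsq_mul. unfold Cnsq. nra.
  - assert (Heig : forall g, L g -> exists z, nu g eta = hscal z eta).
    { intros g Lg. destruct (Hfix (nu g)) as (z & _ & Ez); [apply Hnu| |now exists z].
      intros [k Lk]. exists (exist _ (gmul (ginv g) k) (LM _ _ (LV _ Lg) Lk)). simpl.
      destruct Hnu as [_ Hm]. now rewrite <- Hm, gmul_inv_cancel_r. }
    set (g := gpow (gcomm a b) n) in *.
    assert (Lg : L g).
    { unfold g, gcomm. clear -L1 LM LV La Lb. induction n; simpl; auto 10. }
    assert (Eg : nu g eta = eta) by now apply (hom_comm_fixes_eigenvector nu L).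
    specialize (Ho (exist _ gone L1)). simpl in Ho. rewrite hom_one in Ho by easy.
    pose proof (cauchy_schwarz (hsub (mu g xi) (nu g xi)) eta) as CS.
    rewrite Heta, Rmult_1_r in CS. specialize (Hclose g Lg).
    (* [mu g] flips the sign of [xi], whereas [nu g] fixes [eta] and so preserves its product with
       [xi]: the two contributions add up instead of cancelling. *)
    assert (E : inner (hsub (mu g xi) (nu g xi)) eta = Cmul (mkC (-2) 0) (inner xi eta)).
    { unfold hsub. rewrite hopp_scal, inner_add_l, inner_scal_l, Hmu, HPI, inner_scal_l by easy.
      rewrite <- Eg at 2. rewrite Hin.
      apply Cx_eq; simpl; rewrite cos_PI, sin_PI; ring. }
    rewrite E, Cnsq_mul in CS. unfold Cnsq at 1 in CS. simpl in CS. nra.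
Qed.

Lemma free_subgroup_far_quasirep (G : Group) (delta : R) :
  has_nonabelian_free_subgroup G -> 0 < delta ->
  exists (H : HilbertSpace) (mu : G -> H -> H),
    is_unitary_map mu /\ unital mu /\ defect_le mu delta /\ D_ge mu (1/2).
Proof.
  intros HG Hdelta.
  destruct (free_subgroup_quasimorphism HG) as (L & q & a & b & HL & La & Lb & q1 & Hq & Hn).
  pose proof PI_RGT_0 as PPI.
  destruct (inv_nat_small (delta / (3 * PI))) as [N HN]; [apply Rdiv_lt_0_compat; lra|].
  assert (PN : 0 < INR (S N)) by (apply lt_0_INR; lia).
  assert (Pi : 0 < / INR (S N)) by now apply Rinv_0_lt_compat.
  (* The choice of [N] makes 3 theta < delta, while S N steps of theta add up to exactly PI. *)
  set (theta := PI * / INR (S N)).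
  destruct (induced_quasirep L q theta delta) as (H & mu & xi & Hu & H1 & Hd & Hxi & Hmu); auto.
  - unfold theta. nra.
  - apply (Rmult_lt_compat_l (3 * PI)) in HN; [|lra].
    replace (3 * PI * (delta / (3 * PI))) with delta in HN by (field; lra).
    unfold theta. lra.
  - exists H, mu. do 3 (split; [easy|]).
    apply (far_from_hom mu L q theta xi a b (S N)); auto.
    rewrite Hn. unfold theta. field. lra.
Qed.

Theorem theorem0p2 (G : Group) :
  has_nonabelian_free_subgroup G ->
  ~ strongly_Ulam_stable G /\
  (forall delta, 0 < delta -> F_ge G delta (sqrt 3 / 16)).
Proof.
  intros HG. split.
  (* Any threshold below 1/2 would do; 3/8 separates the upper bound 1/4 from the lower bound
     1/2. *)
  - intros Hs. destruct (Hs (1/4)) as (delta0 & P0 & Hle); [lra|].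
    destruct (free_subgroup_far_quasirep G (delta0 / 2) HG) as (H & mu & Hu & H1 & Hd & HD);
      [lra|].
    destruct (Hle (delta0 / 2) ltac:(lra) H mu Hu H1 Hd (3/8) ltac:(lra)) as (nu & Hnu & Hdist).
    apply (HD (3/8) ltac:(lra) nu Hnu Hdist).
  - intros delta Pd c Hc.
    destruct (free_subgroup_far_quasirep G delta HG Pd) as (H & mu & Hu & H1 & Hd & HD).
    exists H, mu. do 3 (split; [easy|]). intros c' Hc'. apply HD.
    assert (sqrt 3 <= 2).
    { rewrite <- (sqrt_square 2) by lra. apply sqrt_le_1_alt. lra. }
    lra.
Qed.
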